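(* Let $b$ be a locally finite graph over $(X,m)$, $q:X\to\mathbb{R}$, let the associated form $h$ be bounded from below on $\ell^2(X,m)$, and let $d$ be an intrinsic metric with jump size $1$. Let $\lambda<\lambda_0^{\mathrm{ess}}(H)$. Let $u$ be either (a) an approximable function $u\in\mathcal{F}$ that is a solution of $(\mathcal{H}-\lambda)u=0$ or a positive subsolution (i.e. $u\ge0$ and $(\mathcal{H}-\lambda)u\le0$), or (b) a solution $u\in D(H)$ of $(\mathcal{H}-\lambda)u=0$, where in this case $q\in V$ is assumed. Then, for a fixed $o\in X$, there is $r>0$ such that $$u\in\ell^2(X,e^{rd(o,\cdot)}m).$$ Specifically, one can choose any $r>0$ with $r^2\left(\frac{1+e^r}{16}\right)<\lambda_0^{\mathrm{ess}}(H)-\lambda=:a$, which in the case $a\le1$ is satisfied by $r=2ae^{-a}$.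
   Context: $X$ is an infinite countable set, $m:X\to(0,\infty)$, and a graph $b$ over $(X,m)$ is a symmetric function $b:X\times X\to[0,\infty)$ with zero diagonal and $\sum_{y}b(x,y)<\infty$ for all $x$; the graph is locally finite if $\#\{y:b(x,y)>0\}<\infty$ for all $x$. $C(X)$ is the space of real functions on $X$, $C_c(X)$ those with finite support. For $f\in C(X)$, $|\nabla f|^2(x)=\frac{1}{2m(x)}\sum_{y}b(x,y)(f(x)-f(y))^2$. For $q:X\to\mathbb{R}$, $h(\varphi)=h_{b,q}(\varphi)=\sum_{X}(|\nabla\varphi|^2+q\varphi^2)m$ for $\varphi\in C_c(X)$. $h$ bounded from below on $\ell^2(X,m)$ means $h(\varphi)\ge -C\sum_X\varphi^2m$ on $C_c(X)$ for some $C$; then $h$ is closable, its closure is again denoted $h$ with domain $D(h)$, and $H$ is the associated self-adjoint operator with domain $D(H)$. $\lambda_0^{\mathrm{ess}}(H)$ is the infimum of the essential spectrum of $H$ ($+\infty$ if it is empty). $H$ is a restriction of the formal operator $\mathcal{H}f(x)=\frac1{m(x)}\sum_y b(x,y)(f(x)-f(y))+q(x)f(x)$, defined on $\mathcal{F}=\{f\in C(X):\sum_y b(x,y)|f(y)|<\infty\ \forall x\in X\}$. $V$ is the set of $q\in C(X)$, $q=q_+-q_-$ (positive and negative parts), such that for some $\varepsilon>0,C>0$: $\sum_X q_-\varphi^2m\le(1-\varepsilon)h_{b,q_+}(\varphi)+C\sum_X\varphi^2m$ for all $\varphi\in C_c(X)$. A function $u\in\mathcal{F}$ is approximable if there is a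 sequence $(\varphi_n)$ in $C_c(X)$ with $0\le\varphi_n\nearrow1$ pointwise and $\lim_{n\to\infty}\sum_Xu^2|\nabla\varphi_n|^2m=0$. An intrinsic metric is a pseudo-metric $d:X\times X\to[0,\infty)$ (symmetric, zero on the diagonal, triangle inequality) with $\sum_yb(x,y)d(x,y)^2\le m(x)$ for all $x$; its jump size is $\sup\{d(x,y):b(x,y)>0\}$. For a weight $\mu\ge0$, $u\in\ell^2(X,\mu)$ means $\sum_Xu^2\mu<\infty$. *)

(* Defs.v *)
From HB Require Import structures.
From mathcomp Require Import all_boot all_order all_algebra.
From mathcomp Require Import all_classical all_reals all_analysis.
Set Implicit Arguments.
Unset Strict Implicit.
Unset Printing Implicit Defensive.
Import Order.TTheory GRing.Theory Num.Theory.
Import numFieldNormedType.Exports.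
Local Open Scope classical_set_scope.
Local Open Scope ring_scope.

(* Sums of nonnegative terms over X are [\esum]s, with values in [\bar R].
   [rsum F] is the real sum of an absolutely summable signed family F; it is a
   junk value when F is not absolutely summable. *)
Definition rsum (R : realType) (X : choiceType) (F : X -> R) : R :=
  fine (\esum_(x in [set: X]) (Num.max (F x) 0)%:E)
  - fine (\esum_(x in [set: X]) (Num.max (- F x) 0)%:E).

Definition is_graph (R : realType) (X : choiceType) (b : X -> X -> R) : Prop :=
  [/\ forall x y, 0 <= b x y,
      forall x y, b x y = b y x,
      forall x, b x x = 0
    & forall x, (\esum_(y in [set: X]) (b x y)%:E < +oo)%E].

Definition locally_finite (R : realType) (X : choiceType) (b : X -> X -> R) :
    Prop :=
  forall x, finite_set [set y | 0 < b x y].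

Definition Cc (R : realType) (X : choiceType) : set (X -> R) :=
  [set f | finite_set [set x | f x != 0]].

Definition norm2 (R : realType) (X : choiceType) (w f : X -> R) : \bar R :=
  \esum_(x in [set: X]) (f x ^+ 2 * w x)%:E.

Definition l2 (R : realType) (X : choiceType) (w : X -> R) : set (X -> R) :=
  [set f | (norm2 w f < +oo)%E].

Definition inner (R : realType) (X : choiceType) (m f g : X -> R) : R :=
  rsum (fun x => f x * g x * m x).

Definition gradsq (R : realType) (X : choiceType) (b : X -> X -> R)
    (m f : X -> R) (x : X) : \bar R :=
  ((2 * m x)^-1%:E *
   \esum_(y in [set: X]) (b x y * (f x - f y) ^+ 2)%:E)%E.

(* For f in [Cc], the gradient is finite everywhere, and the sum is absolutely
   convergent. *)
Definition qform (R : realType) (X : choiceType) (b : X -> X -> R)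
    (m q f : X -> R) : R :=
  rsum (fun x => (fine (gradsq b m f x) + q x * f x ^+ 2) * m x).

Definition bounded_from_below (R : realType) (X : choiceType)
    (b : X -> X -> R) (m q : X -> R) : Prop :=
  exists C : R, forall f, Cc f ->
    - C * rsum (fun x => f x ^+ 2 * m x) <= qform b m q f.

(* phi is a sequence in [Cc] which converges to u in l2(X, m) and is Cauchy
   with respect to the form. *)
Definition form_approx (R : realType) (X : choiceType) (b : X -> X -> R)
    (m q : X -> R) (phi : nat -> X -> R) (u : X -> R) : Prop :=
  [/\ forall n, Cc (phi n),
      norm2 m (phi n \- u) @[n --> \oo] --> 0%E
    & forall e : R, 0 < e -> exists N : nat, forall n k : nat,
        (N <= n)%N -> (N <= k)%N -> `|qform b m q (phi n \- phi k)| < e].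

(* Domain D(h) of the closure of the form. *)
Definition dom_form (R : realType) (X : choiceType) (b : X -> X -> R)
    (m q : X -> R) : set (X -> R) :=
  [set u | l2 m u /\ exists phi, form_approx b m q phi u].

(* The closed form on the diagonal: the limit of the form along an
   approximating sequence. Since a form bounded from below is closable, this
   limit exists and does not depend on the sequence. *)
Definition cform (R : realType) (X : choiceType) (b : X -> X -> R)
    (m q u : X -> R) : R :=
  xget 0 [set s : R | exists phi, form_approx b m q phi u /\
                        qform b m q (phi n) @[n --> \oo] --> s].

Definition cform2 (R : realType) (X : choiceType) (b : X -> X -> R)
    (m q u v : X -> R) : R :=
  (cform b m q (u \+ v) - cform b m q (u \- v)) / 4.

(* [opH b m q u f] says that u is in D(H) and H u = f, where H is the
   self-adjoint operator associated with the closed form. As D(h) is dense in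
   l2(X, m), f is determined by u. *)
Definition opH (R : realType) (X : choiceType) (b : X -> X -> R)
    (m q u f : X -> R) : Prop :=
  [/\ dom_form b m q u, l2 m f
    & forall v, dom_form b m q v -> cform2 b m q u v = inner m f v].

Definition domH (R : realType) (X : choiceType) (b : X -> X -> R)
    (m q : X -> R) : set (X -> R) :=
  [set u | exists f, opH b m q u f].

(* Resolvent set: H - s is a bijection from D(H) onto l2(X, m) with bounded
   inverse. As H is self-adjoint, only real s matter for the spectrum. *)
Definition resolvent_set (R : realType) (X : choiceType) (b : X -> X -> R)
    (m q : X -> R) : set R :=
  [set s |
     (forall f, l2 m f ->
        exists! u, opH b m q u (fun x => f x + s * u x)) /\
     (exists C : R, forall u g, opH b m q u g ->
        (norm2 m u <= C%:E * norm2 m (fun x => g x - s * u x)%R)%E)].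

Definition spectrum (R : realType) (X : choiceType) (b : X -> X -> R)
    (m q : X -> R) : set R :=
  ~` resolvent_set b m q.

Definition eigenspace (R : realType) (X : choiceType) (b : X -> X -> R)
    (m q : X -> R) (s : R) : set (X -> R) :=
  [set u | opH b m q u (fun x => s * u x)].

Definition finite_dim (R : realType) (X : choiceType) (E : set (X -> R)) :
    Prop :=
  exists (n : nat) (v : 'I_n -> X -> R), forall u, E u ->
    exists c : 'I_n -> R, forall x, u x = \sum_(i < n) c i * v i x.

(* Isolated points of the spectrum that are eigenvalues of finite
   multiplicity. *)
Definition discrete_spectrum (R : realType) (X : choiceType)
    (b : X -> X -> R) (m q : X -> R) : set R :=
  [set s | [/\ spectrum b m q s,
      exists2 e : R, 0 < e &
        forall t, spectrum b m q t -> `|t - s| < e -> t = s,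
      exists u, eigenspace b m q s u /\ (exists x, u x != 0)
    & finite_dim (eigenspace b m q s)]].

Definition essential_spectrum (R : realType) (X : choiceType)
    (b : X -> X -> R) (m q : X -> R) : set R :=
  spectrum b m q `\` discrete_spectrum b m q.

Definition lambda0_ess (R : realType) (X : choiceType) (b : X -> X -> R)
    (m q : X -> R) : \bar R :=
  ereal_inf [set s%:E | s in essential_spectrum b m q].

Definition domF (R : realType) (X : choiceType) (b : X -> X -> R) :
    set (X -> R) :=
  [set f | forall x, (\esum_(y in [set: X]) (b x y * `|f y|)%:E < +oo)%E].

Definition formalH (R : realType) (X : choiceType) (b : X -> X -> R)
    (m q f : X -> R) (x : X) : R :=
  (m x)^-1 * rsum (fun y => b x y * (f x - f y)) + q x * f x.

Definition solution (R : realType) (X : choiceType) (b : X -> X -> R)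
    (m q : X -> R) (lam : R) (u : X -> R) : Prop :=
  domF b u /\ forall x, formalH b m q u x - lam * u x = 0.

Definition positive_subsolution (R : realType) (X : choiceType)
    (b : X -> X -> R) (m q : X -> R) (lam : R) (u : X -> R) : Prop :=
  [/\ domF b u, forall x, 0 <= u x
    & forall x, formalH b m q u x - lam * u x <= 0].

Definition approximable (R : realType) (X : choiceType) (b : X -> X -> R)
    (m u : X -> R) : Prop :=
  domF b u /\
  exists phi : nat -> X -> R,
    [/\ forall n, Cc (phi n),
        forall n x, 0 <= phi n x /\ phi n x <= phi n.+1 x,
        forall x, phi n x @[n --> \oo] --> (1 : R)
      & (\esum_(x in [set: X])
           ((u x ^+ 2)%:E * gradsq b m (phi n) x * (m x)%:E))%E
          @[n --> \oo] --> 0%E].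

Definition pospart (R : realType) (X : Type) (q : X -> R) (x : X) : R :=
  Num.max (q x) 0.

Definition negpart (R : realType) (X : Type) (q : X -> R) (x : X) : R :=
  Num.max (- q x) 0.

Definition classV (R : realType) (X : choiceType) (b : X -> X -> R)
    (m : X -> R) : set (X -> R) :=
  [set q | exists eps C : R, [/\ 0 < eps, 0 < C
    & forall f, Cc f ->
        rsum (fun x => negpart q x * f x ^+ 2 * m x) <=
          (1 - eps) * qform b m (pospart q) f
          + C * rsum (fun x => f x ^+ 2 * m x)]].

Definition intrinsic_metric (R : realType) (X : choiceType)
    (b : X -> X -> R) (m : X -> R) (d : X -> X -> R) : Prop :=
  [/\ forall x y, 0 <= d x y,
      forall x, d x x = 0,
      forall x y, d x y = d y x,
      forall x y z, d x z <= d x y + d y z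
    & forall x,
        (\esum_(y in [set: X]) (b x y * d x y ^+ 2)%:E <= (m x)%:E)%E].

Definition jump_size (R : realType) (X : choiceType) (b : X -> X -> R)
    (d : X -> X -> R) : \bar R :=
  ereal_sup [set (d p.1 p.2)%:E | p in [set p : X * X | 0 < b p.1 p.2]].

(* Main.v *)
(* Below [lambda0_ess] the form is bounded from below outside a finite set (Persson): minimising
   the Rayleigh quotient on the orthogonal complement of finitely many eigenfunctions gives a point
   of the spectrum, which, being discrete, carries a new eigenfunction; infinitely many of these
   would accumulate at a point of the essential spectrum. So finitely many eigenfunctions suffice,
   and functions supported far out are almost orthogonal to them.
   The decay is then Agmon's argument. For a solution [u], the ground state transform turns
   [h(u g) - lam |u g|^2] into the sum of [b x y * u x * u y * (g x - g y)^2 / 2], which is at most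
   the sum of [u^2 |grad g|^2 m]. For [g = exp(r d(o, .) / 2)], truncated and set to 0 on the finite
   set, the trapezoidal bound on [exp] gives [|grad g|^2 <= r^2 (1 + e^r) / 16 * g^2] away from that
   set, and this is absorbed by the lower bound of the form. To get finitely supported functions,
   an approximable [u] allows to multiply [g] by the cutoffs; for [u] in the operator domain, [u] is
   replaced by its approximants in the form norm, and [classV] makes multiplication by [g ^ 2]
   bounded in that norm. *)
Require Import Defs.
From mathcomp Require Import all_boot all_order all_algebra finmap.
From mathcomp Require Import all_classical all_reals all_analysis.
From mathcomp Require summability.
From mathcomp Require Import ring lra.
Set Implicit Arguments.
Unset Strict Implicit.
Unset Printing Implicit Defensive.
Import Order.TTheory GRing.Theory Num.Theory.
Import numFieldNormedType.Exports.
Local Open Scope classical_set_scope.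
Local Open Scope ring_scope.

(** The spectrum is given through resolvents alone, so spectral statements are reached without
    functional calculus: each is a Cauchy-Schwarz inequality for a nonnegative quadratic form,
    tested on a near-minimiser and its image under a bounded inverse. For the same reason the
    eigenfunction at an isolated minimum is built by iterating a resolvent, since a minimising
    sequence need not converge. In the decay estimate the order of two limits matters. For a fixed
    truncation level of the weight, the passage to finitely supported functions costs errors whose
    constants depend on that level; they vanish along the approximating sequence. What remains is
    the contribution of the neighbourhood of the finite set where the weight was cut to 0. It is
    bounded independently of the level, which may then grow. Local finiteness keeps that
    neighbourhood finite. It also makes every value of the formal operator a finite sum, so that
    pointwise convergence is enough against a finitely supported function. *)

Local Notation tot X := (@summability.totally X).
#[local] Existing Instance summability.totally_filter.

(** * Unordered sums *)

Section Sums.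
Context {R : realType} {X : choiceType}.
Implicit Types (F G : X -> R) (A B : {fset X}).

(** Limit of the partial sums along finite sets ordered by inclusion. In this form linearity,
    uniqueness and comparison of sums are those of limits along a filter, and an identity between
    finitely supported sums only has to be checked on all large finite sets. *)
Definition hsum F (v : R) : Prop :=
  (fun A : {fset X} => \sum_(x <- A) F x) @ tot X --> v.

Lemma near_totally A : \forall B \near tot X, (A `<=` B)%fset.
Proof. by exists A. Qed.

Lemma hsum_unique F v w : hsum F v -> hsum F w -> v = w.
Proof. by move=> hv hw; apply: (cvg_unique _ hv hw). Qed.

Lemma hsumD F G v w : hsum F v -> hsum G w -> hsum (F \+ G) (v + w).
Proof.
move=> hv hw; rewrite /hsum.
under eq_cvg do rewrite /= big_split /=.
exact: cvgD.
Qed.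

Lemma hsumZ c F v : hsum F v -> hsum (fun x => c * F x) (c * v).
Proof.
move=> hv; rewrite /hsum.
under eq_cvg do rewrite -mulr_sumr.
exact: cvgMl_tmp.
Qed.

Lemma hsum_near F v : (\forall B \near tot X, \sum_(x <- (B : {fset X})) F x = v) -> hsum F v.
Proof. by move=> h; apply: cvg_near_cst. Qed.

Lemma hsum_nearE F v c : hsum F v ->
  (\forall B \near tot X, \sum_(x <- (B : {fset X})) F x = c) -> v = c.
Proof. by move=> h1 /hsum_near; exact: hsum_unique. Qed.

Lemma big_fset_supp F A B : (A `<=` B)%fset -> (forall x, x \notin A -> F x = 0) ->
  \sum_(x <- B) F x = \sum_(x <- A) F x.
Proof.
move=> AB FA; apply/esym/big_fset_incl => // x _ xA; exact: FA.
Qed.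

Lemma le_sum_fset F A B : (forall x, 0 <= F x) -> (A `<=` B)%fset ->
  \sum_(x <- A) F x <= \sum_(x <- B) F x.
Proof.
move=> F0 AB; pose G x := if x \in A then F x else 0.
have -> : \sum_(x <- A) F x = \sum_(x <- B) G x.
  rewrite (big_fset_supp AB) => [|x /negbTE xA]; last by rewrite /G xA.
  by apply: eq_big_seq => x xA; rewrite /G xA.
by apply: ler_sum => x _; rewrite /G; case: ifP.
Qed.

Lemma sum_le_esum F A : (forall x, 0 <= F x) ->
  ((\sum_(x <- A) F x)%:E <= \esum_(x in [set: X]) (F x)%:E)%E.
Proof.
move=> F0; apply: esum_ge; exists [set` A]; first by split=> //; exact: finite_fset.
by rewrite -fsbig_seq//= sumEFin.
Qed.

Lemma esum_le_ub F (C : R) : (forall A, \sum_(x <- A) F x <= C) ->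
  (\esum_(x in [set: X]) (F x)%:E <= C%:E)%E.
Proof.
move=> h; apply: ge_ereal_sup => _ /= [S [finS _] <-].
by rewrite fsbig_finite//= sumEFin lee_fin.
Qed.

Lemma esum_hsum F : (forall x, 0 <= F x) ->
  (\esum_(x in [set: X]) (F x)%:E < +oo)%E ->
  hsum F (fine (\esum_(x in [set: X]) (F x)%:E)).
Proof.
move=> F0 Foo; set s := esum _ _.
have s0 : (0 <= s)%E by apply: esum_ge0 => x _; rewrite lee_fin.
have sfin : s \is a fin_num by rewrite ge0_fin_numE.
apply/cvgrPdist_lt => e e0.
have [_ /= [S [finS _] <-] hS] := ub_ereal_sup_adherent e0 sfin.
exists (fset_set S) => // B /= SB.
have := sum_le_esum B F0; rewrite -/s -(fineK sfin) lee_fin => h1.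
move: hS; rewrite -/(esum _ _) -/s -(fineK sfin) fsbig_finite//= sumEFin -EFinB lte_fin => h2.
have h3 := le_sum_fset F0 SB.
rewrite ger0_norm ?subr_ge0//; lra.
Qed.

Lemma hsum_esum F v : (forall x, 0 <= F x) -> hsum F v ->
  \esum_(x in [set: X]) (F x)%:E = v%:E.
Proof.
move=> F0 Fv.
have h A : \sum_(x <- A) F x <= v.
  apply: (cvgr_to_ge Fv).
  by exists A => // B; exact: le_sum_fset.
have foo : (\esum_(x in [set: X]) (F x)%:E < +oo)%E.
  exact: le_lt_trans (esum_le_ub h) (ltry _).
have := hsum_unique Fv (esum_hsum F0 foo) => ->.
by rewrite fineK// ge0_fin_numE// esum_ge0// => x _; rewrite lee_fin.
Qed.

Lemma hsum_sum_le F v A : (forall x, 0 <= F x) -> hsum F v -> \sum_(x <- A) F x <= v.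
Proof. by move=> F0 /(hsum_esum F0) h; have := sum_le_esum A F0; rewrite h lee_fin. Qed.

Lemma hsum_le_ub F v (C : R) : hsum F v -> (forall A, \sum_(x <- A) F x <= C) -> v <= C.
Proof.
move=> hv h; apply: (cvgr_to_le hv).
by exists fset0.
Qed.

Lemma hsum_ge0 F v : (forall x, 0 <= F x) -> hsum F v -> 0 <= v.
Proof. by move=> F0 /(hsum_sum_le fset0 F0); rewrite big_seq_fset0. Qed.

Lemma bounded_hsum F (C : R) : (forall x, 0 <= F x) ->
  (forall A, \sum_(x <- A) F x <= C) ->
  hsum F (fine (\esum_(x in [set: X]) (F x)%:E)).
Proof.
by move=> F0 h; apply: esum_hsum => //; exact: le_lt_trans (esum_le_ub h) (ltry _).
Qed.

(** A bound on the absolute sums makes positive and negative part summable, so that [rsum] is not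
    its junk value. *)
Lemma rsum_hsum F (C : R) : (forall A, \sum_(x <- A) `|F x| <= C) -> hsum F (rsum F).
Proof.
move=> h.
have Fp x : 0 <= Num.max (F x) 0 by rewrite le_max lexx orbT.
have Fn x : 0 <= Num.max (- F x) 0 by rewrite le_max lexx orbT.
have hp : hsum (fun x => Num.max (F x) 0) (fine (\esum_(x in [set: X]) (Num.max (F x) 0)%:E)).
  apply: (@bounded_hsum _ C) => // A; apply: le_trans (h A).
  by apply: ler_sum => x _; rewrite ge_max normr_ge0 ler_norm.
have hn : hsum (fun x => Num.max (- F x) 0) (fine (\esum_(x in [set: X]) (Num.max (- F x) 0)%:E)).
  apply: (@bounded_hsum _ C) => // A; apply: le_trans (h A).
  by apply: ler_sum => x _; rewrite ge_max normr_ge0 -normrN ler_norm.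
have := hsumD hp (hsumZ (c := -1) hn); rewrite mulN1r -/(rsum F).
congr hsum; apply/funext => x /=; rewrite !maxEle; case: ifP; case: ifP; lra.
Qed.

Lemma rsum_fin F A : (forall x, x \notin A -> F x = 0) -> rsum F = \sum_(x <- A) F x.
Proof.
move=> FA; apply: (@hsum_nearE F); last first.
  by exists A => // B AB; exact: big_fset_supp.
apply: (@rsum_hsum _ (\sum_(x <- A) `|F x|)) => B.
rewrite -(@big_fset_supp (fun x => `|F x|) A (A `|` B)%fset).
- by apply: le_sum_fset => //; exact: fsubsetUr.
- exact: fsubsetUl.
- by move=> x /FA ->; rewrite normr0.
Qed.

Lemma esum_fin F A : (forall x, 0 <= F x) -> (forall x, x \notin A -> F x = 0) ->
  \esum_(x in [set: X]) (F x)%:E = (\sum_(x <- A) F x)%:E.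
Proof.
move=> F0 FA; apply: hsum_esum => //; apply: hsum_near.
by exists A => // B AB; exact: big_fset_supp.
Qed.

End Sums.

(** Source of every Cauchy-Schwarz inequality below, also for forms such as [h - mu] that are
    nonnegative only on a subspace: nonnegativity along one line is all that is required. *)
Lemma discriminant (R : realFieldType) (a b c : R) :
  (forall t, 0 <= a + 2 * t * b + t ^+ 2 * c) -> b ^+ 2 <= a * c.
Proof.
move=> h; have a0 : 0 <= a by have := h 0; rewrite expr0n /= !(mulr0, mul0r) !addr0.
have c0 : 0 <= c.
  rewrite leNgt; apply/negP => c0.
  have ic : c^-1 < 0 by rewrite invr_lt0.
  have cc : c * c^-1 = 1 by rewrite divff// lt_eqF.
  (* The values at [t] and [- t] add up to [2 * (a + t ^+ 2 * c)], free of [b]. This [t] is at least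
     1 and makes [t * c] equal to [c - (a + 1)], so the sum is negative. *)
  pose t := 1 - (a + 1) * c^-1.
  have t1 : 1 <= t by rewrite /t; nra.
  have tc : t * c = c - (a + 1) by rewrite /t mulrBl mul1r -mulrA (mulrC c^-1) cc mulr1.
  have : t ^+ 2 * c <= t * c by rewrite expr2 -mulrA ler_neMl//; lra.
  have := h t; have := h (- t); rewrite sqrrN tc; lra.
have [c00|cn] := eqVneq c 0.
  have [->|bn] := eqVneq b 0; first by rewrite c00 mulr0 expr0n.
  have := h (- (a + 1) / (2 * b)); rewrite c00 mulr0 addr0.
  have -> : 2 * (- (a + 1) / (2 * b)) * b = - (a + 1) by field.
  lra.
have := h (- b / c).
have -> : a + 2 * (- b / c) * b + (- b / c) ^+ 2 * c = (a * c - b ^+ 2) / c by field.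
have cp : 0 < c by rewrite lt_neqAle eq_sym cn.
by rewrite pmulr_lge0 ?invr_gt0// subr_ge0.
Qed.

Lemma cvg_sumr (R : realType) (T : Type) (F : set_system T) {FF : Filter F} (I : Type)
    (s : seq I) (f : I -> T -> R) (l : I -> R) :
  (forall i, f i t @[t --> F] --> l i) ->
  \sum_(i <- s) f i t @[t --> F] --> \sum_(i <- s) l i.
Proof.
move=> h; elim: s => [|i s IH].
  by rewrite big_nil; under eq_cvg do rewrite big_nil; exact: cvg_cst.
by rewrite big_cons; under eq_cvg do rewrite big_cons; exact: cvgD.
Qed.

(** * The space l2 *)

Section L2.
Context {R : realType} {X : choiceType} (m : X -> R).
Hypothesis m_gt0 : forall x, 0 < m x.
Implicit Types f g h : X -> R.

Let m0 x : 0 <= m x. Proof. exact/ltW. Qed.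

Lemma l2P f : l2 m f <-> exists C : R, forall A : {fset X}, \sum_(x <- A) f x ^+ 2 * m x <= C.
Proof.
have F0 x : 0 <= f x ^+ 2 * m x by rewrite mulr_ge0// sqr_ge0.
split=> [h|[C h]]; last exact: le_lt_trans (esum_le_ub h) (ltry _).
exists (fine (norm2 m f)) => A; apply: hsum_sum_le => //.
exact: esum_hsum.
Qed.

Lemma l2_hsum f g : l2 m f -> l2 m g -> hsum (fun x => f x * g x * m x) (inner m f g).
Proof.
move=> /l2P[C hC] /l2P[C' hC']; apply: (@rsum_hsum _ _ _ (C + C')) => A.
apply: le_trans (lerD (hC A) (hC' A)); rewrite -big_split /=.
apply: ler_sum => x _; rewrite normrM (ger0_norm (m0 x)) -mulrDl ler_wpM2r//.
by rewrite ler_norml; apply/andP; split; nra.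
Qed.

Lemma inner_norm2 f : l2 m f -> norm2 m f = (inner m f f)%:E.
Proof.
move=> lf; have := l2_hsum lf lf => h; apply: hsum_esum => [x|].
  by rewrite mulr_ge0// sqr_ge0.
by move: h; congr hsum; apply/funext => x; rewrite expr2.
Qed.

Lemma inner_rsum f : rsum (fun x => f x ^+ 2 * m x) = inner m f f.
Proof. by rewrite /inner; congr rsum; apply/funext => x; rewrite expr2. Qed.

Lemma l2D f g : l2 m f -> l2 m g -> l2 m (f \+ g).
Proof.
move=> /l2P[C hC] /l2P[C' hC']; apply/l2P; exists (2 * C + 2 * C') => A.
have := hC A; have := hC' A => h1 h2.
apply: (@le_trans _ _ (\sum_(x <- A) (2 * (f x ^+ 2 * m x) + 2 * (g x ^+ 2 * m x)))).
  by apply: ler_sum => x _; have := m0 x; have := sqr_ge0 (f x - g x) => /=; nra.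
by rewrite big_split /= -!mulr_sumr; lra.
Qed.

Lemma l2Z c f : l2 m f -> l2 m (fun x => c * f x).
Proof.
move=> /l2P[C hC]; apply/l2P; exists (c ^+ 2 * C) => A.
under eq_bigr do rewrite exprMn -mulrA.
by rewrite -mulr_sumr ler_wpM2l// sqr_ge0.
Qed.

Lemma l2B f g : l2 m f -> l2 m g -> l2 m (f \- g).
Proof.
move=> hf hg; have -> : f \- g = f \+ (fun x => -1 * g x).
  by apply/funext => x /=; rewrite mulN1r.
by apply: l2D => //; exact: l2Z.
Qed.

Lemma innerC f g : inner m f g = inner m g f.
Proof. by rewrite /inner; congr rsum; apply/funext => x; rewrite [f x * _]mulrC. Qed.

Lemma innerDl f g h : l2 m f -> l2 m g -> l2 m h ->
  inner m (f \+ g) h = inner m f h + inner m g h.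
Proof.
move=> hf hg hh; apply: (hsum_unique (l2_hsum (l2D hf hg) hh)).
have := hsumD (l2_hsum hf hh) (l2_hsum hg hh).
by congr hsum; apply/funext => x /=; rewrite -!mulrDl.
Qed.

Lemma innerZl c f h : l2 m f -> l2 m h ->
  inner m (fun x => c * f x) h = c * inner m f h.
Proof.
move=> hf hh; apply: (hsum_unique (l2_hsum (l2Z c hf) hh)).
have := hsumZ (c := c) (l2_hsum hf hh).
by congr hsum; apply/funext => x /=; rewrite !mulrA.
Qed.

Lemma innerBl f g h : l2 m f -> l2 m g -> l2 m h ->
  inner m (f \- g) h = inner m f h - inner m g h.
Proof.
move=> hf hg hh; have -> : f \- g = f \+ (fun x => -1 * g x).
  by apply/funext => x /=; rewrite mulN1r.
by rewrite innerDl ?innerZl ?mulN1r//; exact: l2Z.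
Qed.

Lemma innerDr f g h : l2 m f -> l2 m g -> l2 m h ->
  inner m h (f \+ g) = inner m h f + inner m h g.
Proof. by move=> *; rewrite ![inner m h _]innerC innerDl. Qed.

Lemma innerBr f g h : l2 m f -> l2 m g -> l2 m h ->
  inner m h (f \- g) = inner m h f - inner m h g.
Proof. by move=> *; rewrite ![inner m h _]innerC innerBl. Qed.

Lemma innerZr c f h : l2 m f -> l2 m h ->
  inner m h (fun x => c * f x) = c * inner m h f.
Proof. by move=> *; rewrite ![inner m h _]innerC innerZl. Qed.

Lemma innerBC f g : inner m (f \- g) (f \- g) = inner m (g \- f) (g \- f).
Proof. by rewrite /inner; congr rsum; apply/funext => x /=; ring. Qed.

Lemma inner_ge0 f : l2 m f -> 0 <= inner m f f.
Proof.
move=> hf; apply: hsum_ge0 (l2_hsum hf hf) => x.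
by rewrite -expr2 mulr_ge0// sqr_ge0.
Qed.

Lemma inner_pt f x : l2 m f -> f x ^+ 2 * m x <= inner m f f.
Proof.
move=> hf; have := @hsum_sum_le _ _ _ _ [fset x]%fset _ (l2_hsum hf hf).
by rewrite big_seq_fset1 -expr2; apply => y; rewrite -expr2 mulr_ge0// sqr_ge0.
Qed.

Lemma inner_eq0 f : l2 m f -> inner m f f = 0 -> f = cst 0.
Proof.
move=> hf h; apply/funext => x; have := inner_pt x hf; rewrite h => h1.
apply/eqP; rewrite -sqrf_eq0 eq_le sqr_ge0 andbT.
by move: h1; rewrite pmulr_lle0.
Qed.

Lemma l2_cst0 : l2 m (cst 0).
Proof.
by apply/l2P; exists 0 => A; rewrite big1// => x _; rewrite /= expr0n mul0r.
Qed.

Lemma inner_cst0 f : inner m (cst 0) f = 0.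
Proof.
rewrite /inner (@rsum_fin _ _ _ fset0) ?big_seq_fset0// => x _.
by rewrite /= !mul0r.
Qed.

Lemma innerBB f g : l2 m f -> l2 m g ->
  inner m (f \- g) (f \- g) = inner m f f - 2 * inner m f g + inner m g g.
Proof.
move=> hf hg; have qform2 := l2B hf hg; rewrite innerBl// !innerBr// (innerC g f); ring.
Qed.

Lemma innerDD f g : l2 m f -> l2 m g ->
  inner m (f \+ g) (f \+ g) = inner m f f + 2 * inner m f g + inner m g g.
Proof.
move=> hf hg; have qform2 := l2D hf hg; rewrite innerDl// !innerDr// (innerC g f); ring.
Qed.

Lemma inner_CS f g : l2 m f -> l2 m g -> inner m f g ^+ 2 <= inner m f f * inner m g g.
Proof.
move=> hf hg; apply: discriminant => t; have hz := l2Z t hg.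
have := inner_ge0 (l2D hf hz); rewrite innerDD// innerZr// innerZr// innerZl//.
by rewrite expr2; lra.
Qed.

Lemma CcP f : Cc f <-> exists A : {fset X}, forall x, x \notin A -> f x = 0.
Proof.
split=> [h|[A h]].
  exists (fset_set [set x | f x != 0]) => x; rewrite in_fset_set// notin_setE /=.
  by move/negP; rewrite negbK => /eqP.
apply: sub_finite_set (finite_fset A) => x /=.
by apply: contraNT => /h ->.
Qed.

Lemma Cc_near f : Cc f -> \forall B \near tot X, forall x, x \notin (B : {fset X}) -> f x = 0.
Proof.
move=> /CcP[A hA]; exists A => // B /= /fsubsetP AB x xB; apply: hA.
by apply: contra xB; exact: AB.
Qed.

Lemma CcD f g : Cc f -> Cc g -> Cc (f \+ g).
Proof.
move=> /CcP[A hA] /CcP[B hB]; apply/CcP; exists (A `|` B)%fset => x.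
by rewrite inE negb_or => /andP[/hA h1 /hB h2] /=; rewrite h1 h2 addr0.
Qed.

Lemma Cc_mul f g : Cc g -> Cc (fun x => f x * g x).
Proof.
by move=> /CcP[A hA]; apply/CcP; exists A => x /hA ->; rewrite mulr0.
Qed.

Lemma CcZ c f : Cc f -> Cc (fun x => c * f x).
Proof. exact: Cc_mul. Qed.

Lemma CcB f g : Cc f -> Cc g -> Cc (f \- g).
Proof.
move=> /CcP[A hA] /CcP[B hB]; apply/CcP; exists (A `|` B)%fset => x.
by rewrite inE negb_or => /andP[/hA h1 /hB h2] /=; rewrite h1 h2 subr0.
Qed.

Lemma Cc_l2 f : Cc f -> l2 m f.
Proof.
move=> /CcP[A hA]; apply/l2P; exists (\sum_(x <- A) f x ^+ 2 * m x) => B.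
rewrite -(@big_fset_supp _ _ _ A (A `|` B)%fset).
- apply: le_sum_fset; last exact: fsubsetUr.
  by move=> x; rewrite mulr_ge0// sqr_ge0.
- exact: fsubsetUl.
- by move=> x /hA ->; rewrite expr0n mul0r.
Qed.

Lemma inner_near f g : Cc g ->
  \forall B \near tot X, inner m f g = \sum_(x <- (B : {fset X})) f x * g x * m x.
Proof.
move=> /CcP[A hA]; exists A => // B /= AB; apply: rsum_fin => x xB.
rewrite hA ?mulr0 ?mul0r//; apply: contra xB; exact/fsubsetP.
Qed.

Lemma l2_complete (x : nat -> X -> R) :
  (forall n, l2 m (x n)) ->
  (forall e : R, 0 < e -> exists N, forall n k, (N <= n)%N -> (N <= k)%N ->
     inner m (x n \- x k) (x n \- x k) <= e) ->
  exists y, l2 m y /\ forall e : R, 0 < e -> exists N, forall n, (N <= n)%N ->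
     inner m (x n \- y) (x n \- y) <= e.
Proof.
move=> lx cau.
have cv p : cvgn (fun n => x n p).
  apply: cauchy_cvg; apply: cauchy_exP => e e0.
  have [|N hN] := cau ((e / 2) ^+ 2 * m p); first by rewrite mulr_gt0// exprn_gt0// divr_gt0.
  exists (x N p); exists N => // n /= Nn; rewrite /ball /=.
  have := hN N n (leqnn N) Nn => /(le_trans (inner_pt p (l2B (lx N) (lx n)))) /=.
  rewrite ler_pM2r// => h.
  have e2 : 0 <= e / 2 by lra.
  have : `|x N p - x n p| <= e / 2.
    by rewrite -(ler_pXn2r (ltn0Sn 1)) ?nnegrE// real_normK ?num_real.
  by move=> /le_lt_trans; apply; lra.
pose y p := limn (fun n => x n p).
(* Fatou's lemma on finite sets: the Cauchy bound holds for each finite partial sum, where the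
   pointwise limit in [k] can be taken. *)
have key N e : (forall n k, (N <= n)%N -> (N <= k)%N ->
     inner m (x n \- x k) (x n \- x k) <= e) -> forall n, (N <= n)%N ->
     forall A : {fset X}, \sum_(p <- A) (x n p - y p) ^+ 2 * m p <= e.
  move=> hN n Nn A.
  have : (fun k => \sum_(p <- A) (x n p - x k p) ^+ 2 * m p) @ \oo -->
      \sum_(p <- A) (x n p - y p) ^+ 2 * m p.
    apply: cvg_sumr => p; apply: cvgMr_tmp.
    have c : (fun k => x n p - x k p) @ \oo --> x n p - y p.
      by apply: cvgB; [exact: cvg_cst|exact: cv].
    by rewrite expr2; under eq_cvg do rewrite expr2; exact: cvgM.
  move/cvgr_to_le; apply; exists N => // k /= Nk.
  apply: le_trans (hN n k Nn Nk).
  have lb := l2B (lx n) (lx k).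
  have F0 p : 0 <= (x n \- x k) p * (x n \- x k) p * m p.
    by rewrite -expr2 mulr_ge0// sqr_ge0.
  apply: le_trans (hsum_sum_le A F0 (l2_hsum lb lb)).
  by apply: ler_sum => p _; rewrite /= expr2.
have ly : l2 m y.
  have [N /key hN] := cau 1 ltr01.
  have : l2 m (x N \- y) by apply/l2P; exists 1; exact: hN.
  move/(l2B (lx N)); congr (l2 m); apply/funext => p /=; ring.
exists y; split=> // e e0; have [N /key hN] := cau e e0; exists N => n Nn.
have lb := l2B (lx n) ly; apply: hsum_le_ub (l2_hsum lb lb) _ => A.
apply: le_trans (hN n Nn A); apply: ler_sum => p _ /=; by rewrite -expr2.
Qed.

End L2.

(** * The form on finitely supported functions *)

Section Graph.
Context {R : realType} {X : choiceType} (m : X -> R) (b : X -> X -> R).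
Hypothesis m_gt0 : forall x, 0 < m x.
Hypothesis b_graph : is_graph b.
Hypothesis b_lf : locally_finite b.
Implicit Types (f g q u v w : X -> R) (A B : {fset X}).

Lemma b_ge0 x y : 0 <= b x y. Proof. by case: b_graph. Qed.
Lemma b_sym x y : b x y = b y x. Proof. by case: b_graph. Qed.

Definition nbr x : {fset X} := fset_set [set y | 0 < b x y].

(* [A] together with its neighbours. *)
Definition hull A : {fset X} := (A `|` \bigcup_(x <- A) nbr x)%fset.

Lemma nbrP x y : (y \in nbr x) = (0 < b x y).
Proof. by rewrite in_fset_set//; apply/idP/idP; rewrite inE. Qed.

Lemma notin_nbr x y : y \notin nbr x -> b x y = 0.
Proof. by rewrite nbrP lt_neqAle b_ge0 andbT negbK => /eqP. Qed.

Lemma sub_hull A : (A `<=` hull A)%fset. Proof. exact: fsubsetUl. Qed.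

Lemma hull_b0 A x y : x \in A -> y \notin hull A -> b x y = 0.
Proof.
move=> xA; rewrite inE negb_or => /andP[_ h]; apply: notin_nbr.
by apply: contra h => h; apply/bigfcupP; exists x => //; rewrite xA.
Qed.

(** The form cut down to a finite vertex set. It agrees with the true form for all large [B] once
    the arguments have finite support, so algebraic identities become identities of finite sums. *)
Definition bil q B f g : R :=
  2^-1 * (\sum_(x <- B) \sum_(y <- B) b x y * (f x - f y) * (g x - g y))
  + \sum_(x <- B) q x * f x * g x * m x.

Lemma bilC q B f g : bil q B f g = bil q B g f.
Proof.
rewrite /bil; congr (_ * _ + _).
  by apply: eq_bigr => x _; apply: eq_bigr => y _; ring.
by apply: eq_bigr => x _; ring.
Qed.

Lemma bilDl q B f g h : bil q B (f \+ g) h = bil q B f h + bil q B g h.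
Proof.
rewrite /bil addrACA -mulrDr -!big_split /=; congr (_ * _ + _).
  by apply: eq_bigr => x _; rewrite -big_split; apply: eq_bigr => y _ /=; ring.
by apply: eq_bigr => x _; ring.
Qed.

Lemma bilZl c q B f h : bil q B (fun x => c * f x) h = c * bil q B f h.
Proof.
rewrite /bil mulrDr [c * (2^-1 * _)]mulrCA; congr (_ * _ + _); rewrite mulr_sumr.
  by apply: eq_bigr => x _; rewrite mulr_sumr; apply: eq_bigr => y _ /=; ring.
by apply: eq_bigr => x _; ring.
Qed.

Lemma bilBl q B f g h : bil q B (f \- g) h = bil q B f h - bil q B g h.
Proof.
have -> : f \- g = f \+ (fun x => -1 * g x) by apply/funext => x /=; rewrite mulN1r.
by rewrite bilDl bilZl mulN1r.
Qed.

Lemma bilDr q B f g h : bil q B h (f \+ g) = bil q B h f + bil q B h g.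
Proof. by rewrite ![bil q B h _]bilC bilDl. Qed.

Lemma bilBr q B f g h : bil q B h (f \- g) = bil q B h f - bil q B h g.
Proof. by rewrite ![bil q B h _]bilC bilBl. Qed.

Lemma gradsq_fin f A B x : (forall y, y \notin A -> f y = 0) -> (hull A `<=` B)%fset ->
  gradsq b m f x = ((2 * m x)^-1 * \sum_(y <- B) b x y * (f x - f y) ^+ 2)%:E.
Proof.
move=> hA AB; rewrite /gradsq (@esum_fin _ _ _ B) ?EFinM//.
  by move=> y; rewrite mulr_ge0 ?b_ge0 ?sqr_ge0.
move=> y yB; have yh : y \notin hull A by apply: contra yB; exact/fsubsetP.
have fy : f y = 0 by apply: hA; apply: contra yh; apply/fsubsetP; exact: sub_hull.
have [xA|/hA ->] := boolP (x \in A); first by rewrite (hull_b0 xA yh) mul0r.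
by rewrite fy subrr expr0n mulr0.
Qed.

Lemma qform_near q f : Cc f -> \forall B \near tot X, qform b m q f = bil q B f f.
Proof.
move=> /CcP[A hA]; exists (hull A) => // B /= AB.
rewrite /qform (@rsum_fin _ _ _ B).
  rewrite /bil mulr_sumr -big_split /=; apply: eq_bigr => x _.
  rewrite (gradsq_fin x hA AB) /= mulrDl; congr (_ + _); last by ring.
  have mx : m x != 0 by rewrite gt_eqF.
  rewrite mulrAC invfM -!mulrA mulKf//.
  by congr (_ * _); apply: eq_bigr => y _; rewrite expr2 mulrA.
move=> x xB.
have xh : x \notin hull A by apply: contra xB; exact/fsubsetP.
have fx : f x = 0 by apply: hA; apply: contra xh; apply/fsubsetP; exact: sub_hull.
rewrite (gradsq_fin x hA AB) /= fx expr0n mulr0 addr0 big1 ?mulr0 ?mul0r// => y _.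
have [yA|/hA ->] := boolP (y \in A); last by rewrite subrr expr0n mulr0.
by rewrite b_sym (hull_b0 yA xh) mul0r.
Qed.

(** The same polarisation as in [cform2], so that the convergence of [qform2] to [cform2] reduces to
    two diagonal limits. *)
Definition qform2 q f g : R := (qform b m q (f \+ g) - qform b m q (f \- g)) / 4.

Lemma qform2_near q f g : Cc f -> Cc g -> \forall B \near tot X, qform2 q f g = bil q B f g.
Proof.
move=> hf hg; near=> B; rewrite /qform2.
rewrite (near (qform_near q (CcD hf hg)) B)// (near (qform_near q (CcB hf hg)) B)//.
rewrite (bilDl q B f g) (bilBl q B f g) !(bilDr q B f g) !(bilBr q B f g) (bilC q B g f); field.
Unshelve. all: by end_near. Qed.

Lemma qform_hb q f : Cc f -> qform b m q f = qform2 q f f.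
Proof.
move=> hf; near (tot X) => B.
by rewrite (near (qform_near q hf) B)// (near (qform2_near q hf hf) B).
Unshelve. all: by end_near. Qed.

Lemma qform2C q f g : Cc f -> Cc g -> qform2 q f g = qform2 q g f.
Proof.
move=> hf hg; near (tot X) => B.
by rewrite (near (qform2_near q hf hg) B)// (near (qform2_near q hg hf) B)// bilC.
Unshelve. all: by end_near. Qed.

Lemma qform2Dl q f g h : Cc f -> Cc g -> Cc h -> qform2 q (f \+ g) h = qform2 q f h + qform2 q g h.
Proof.
move=> hf hg hh; near (tot X) => B.
rewrite (near (qform2_near q (CcD hf hg) hh) B)// (near (qform2_near q hf hh) B)//.
by rewrite (near (qform2_near q hg hh) B)// bilDl.
Unshelve. all: by end_near. Qed.

Lemma qform2Zl q c f h : Cc f -> Cc h -> qform2 q (fun x => c * f x) h = c * qform2 q f h.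
Proof.
move=> hf hh; near (tot X) => B.
by rewrite (near (qform2_near q (CcZ c hf) hh) B)// (near (qform2_near q hf hh) B)// bilZl.
Unshelve. all: by end_near. Qed.

Lemma qform2Bl q f g h : Cc f -> Cc g -> Cc h -> qform2 q (f \- g) h = qform2 q f h - qform2 q g h.
Proof.
move=> hf hg hh; near (tot X) => B.
rewrite (near (qform2_near q (CcB hf hg) hh) B)// (near (qform2_near q hf hh) B)//.
by rewrite (near (qform2_near q hg hh) B)// bilBl.
Unshelve. all: by end_near. Qed.

Lemma formalH_fin q f B x : (nbr x `<=` B)%fset ->
  m x * formalH b m q f x = \sum_(y <- B) b x y * (f x - f y) + q x * f x * m x.
Proof.
move=> xB; rewrite /formalH (@rsum_fin _ _ _ B).
  by rewrite mulrDr mulVKf ?gt_eqF//; congr (_ + _); ring.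
by move=> y yB; rewrite notin_nbr ?mul0r//; apply: contra yB; exact/fsubsetP.
Qed.

Lemma double_sum_sym B (F : X -> X -> R) :
  \sum_(x <- B) \sum_(y <- B) F x y = \sum_(x <- B) \sum_(y <- B) F y x.
Proof. exact: exchange_big. Qed.

(** Green's formula: exchanging [x] and [y] folds the terms with [g y] into those with [g x]. Finite
    support is asked of [g] alone, so that [f] may be a solution. *)
Lemma green_near q f g : Cc g -> \forall B \near tot X,
  bil q B f g = \sum_(x <- (B : {fset X})) g x * (m x * formalH b m q f x).
Proof.
move=> /CcP[A hA]; exists (hull A) => // B /= AB; rewrite /bil.
have -> : \sum_(x <- B) \sum_(y <- B) b x y * (f x - f y) * (g x - g y) =
    2 * \sum_(x <- B) \sum_(y <- B) b x y * (f x - f y) * g x.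
  rewrite mulr2n mulrDl mul1r [X in _ = _ + X]double_sum_sym -big_split /=.
  apply: eq_bigr => x _; rewrite -big_split /=; apply: eq_bigr => y _.
  by rewrite (b_sym y x); ring.
rewrite mulKf// -big_split /=; apply: eq_bigr => x _.
have [xA|/hA ->] := boolP (x \in A).
  rewrite (@formalH_fin _ _ B).
    by rewrite mulrDr mulr_sumr; congr (_ + _); [apply: eq_bigr => y _; ring|ring].
  apply: fsubset_trans AB; apply/fsubsetP => y yx; rewrite inE; apply/orP; right.
  by apply/bigfcupP; exists x => //; rewrite xA.
by rewrite big1 => [|y _]; rewrite !(mulr0, mul0r) ?addr0.
Qed.

(* Ground state transform. *)
Lemma bil_ground q B u g :
  bil q B (fun x => u x * g x) (fun x => u x * g x) =
  bil q B u (fun x => u x * g x ^+ 2) +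
  2^-1 * \sum_(x <- B) \sum_(y <- B) b x y * (u x * u y) * (g x - g y) ^+ 2.
Proof.
rewrite /bil addrAC -mulrDr -big_split /=; congr (_ * _ + _).
  by apply: eq_bigr => x _; rewrite -big_split; apply: eq_bigr => y _ /=; ring.
by apply: eq_bigr => x _; ring.
Qed.

(** The product [u x * u y] is at most the mean of the two squares, and the symmetry of [b] merges
    both halves into a single sum. *)
Lemma ground_rem_le B u g :
  2^-1 * \sum_(x <- B) \sum_(y <- B) b x y * (u x * u y) * (g x - g y) ^+ 2 <=
  2^-1 * \sum_(x <- B) u x ^+ 2 * \sum_(y <- B) b x y * (g x - g y) ^+ 2.
Proof.
rewrite ler_pM2l ?invr_gt0//.
have -> : \sum_(x <- B) u x ^+ 2 * \sum_(y <- B) b x y * (g x - g y) ^+ 2 =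
    \sum_(x <- B) \sum_(y <- B) b x y * ((u x ^+ 2 + u y ^+ 2) / 2) * (g x - g y) ^+ 2.
  transitivity (2^-1 * (2 * \sum_(x <- B) \sum_(y <- B)
      b x y * u x ^+ 2 * (g x - g y) ^+ 2)).
    rewrite mulKf//; apply: eq_bigr => x _; rewrite mulr_sumr.
    by apply: eq_bigr => y _; ring.
  rewrite mulr2n mulrDl mul1r [X in _ * (_ + X) = _]double_sum_sym -big_split /=.
  rewrite mulr_sumr; apply: eq_bigr => x _; rewrite -big_split mulr_sumr /=.
  by apply: eq_bigr => y _; rewrite (b_sym y x); field.
apply: ler_sum => x _; apply: ler_sum => y _; rewrite ler_wpM2r ?sqr_ge0// ler_wpM2l ?b_ge0//.
have := sqr_ge0 (u x - u y); rewrite sqrrB; lra.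
Qed.

End Graph.

(** * The closed form *)

Lemma cvg0_sqr_le (R : realType) (x y : nat -> R) :
  (forall n, x n ^+ 2 <= y n) -> y @ \oo --> 0 -> x @ \oo --> 0.
Proof.
move=> xy /cvgrPdist_lt y0; apply/cvgrPdist_lt => e e0.
have e2 : 0 < e ^+ 2 by rewrite exprn_gt0.
have [N _ hN] := y0 _ e2; exists N => // n Nn /=.
have := hN n Nn; rewrite /= !sub0r !normrN => h.
rewrite -(ltr_pXn2r (ltn0Sn 1)) ?nnegrE//; last exact: ltW.
rewrite real_normK ?num_real//; apply: le_lt_trans (xy n) _.
by apply: le_lt_trans h; exact: ler_norm.
Qed.

Lemma cvg0_le (R : realType) (x y : nat -> R) :
  (forall n, 0 <= x n <= y n) -> y @ \oo --> 0 -> x @ \oo --> 0.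
Proof.
move=> xy y0; apply: (squeeze_cvgr _ (cvg_cst 0) y0).
by exists 0%N.
Qed.

Lemma cvg0_lt (R : realType) (x : nat -> R) (e : R) : x @ \oo --> 0 -> 0 < e ->
  exists N, forall n, (N <= n)%N -> `|x n| < e.
Proof.
move=> /cvgrPdist_lt x0 e0; have [N _ hN] := x0 e e0; exists N => n Nn.
by have := hN n Nn; rewrite /= sub0r normrN.
Qed.

Section ClosedForm.
Context {R : realType} {X : choiceType} (m : X -> R) (b : X -> X -> R) (q : X -> R).
Hypothesis m_gt0 : forall x, 0 < m x.
Hypothesis b_graph : is_graph b.
Hypothesis b_lf : locally_finite b.
Implicit Types (f g u v w : X -> R) (A B : {fset X}) (phi psi : nat -> X -> R).
Variable K : R.
Hypothesis hK : forall f, Cc f -> inner m f f <= qform2 m b q f f + K * inner m f f.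

Local Notation qform2 := (qform2 m b q).
Local Notation "<< f , g >>" := (inner m f g).

Lemma qform2_local A f g : Cc f -> (forall x, x \notin A -> g x = 0) ->
  qform2 f g = \sum_(x <- A) g x * (m x * formalH b m q f x).
Proof.
move=> hf gA; have hg : Cc g by apply/CcP; exists A.
near (tot X) => B.
rewrite (near (qform2_near m_gt0 b_graph b_lf q hf hg) B)//.
rewrite (near (green_near m_gt0 b_graph b_lf q f hg) B)//.
apply: big_fset_supp; first by near: B; exact: near_totally.
by move=> x /gA ->; rewrite mul0r.
Unshelve. all: by end_near. Qed.

Lemma formalH_cvg phi u x : (forall y, phi n y @[n --> \oo] --> u y) ->
  m x * formalH b m q (phi n) x @[n --> \oo] --> m x * formalH b m q u x.
Proof.
move=> h; rewrite (formalH_fin m_gt0 b_graph b_lf q u (fsubset_refl _)).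
under eq_cvg do rewrite (formalH_fin m_gt0 b_graph b_lf q _ (fsubset_refl _)).
apply: cvgD; last by apply: cvgMr_tmp; exact: cvgMl_tmp.
by apply: cvg_sumr => y; apply: cvgMl_tmp; exact: cvgB.
Qed.

(** Only the values of [phi n] on and next to [A] enter, so pointwise convergence suffices. This
    weak continuity gives closability and brings the equation for [u] into the form. *)
Lemma qform2_cvg A phi u g : (forall n, Cc (phi n)) -> (forall x, x \notin A -> g x = 0) ->
  (forall y, phi n y @[n --> \oo] --> u y) ->
  qform2 (phi n) g @[n --> \oo] --> \sum_(x <- A) g x * (m x * formalH b m q u x).
Proof.
move=> hp gA h; under eq_cvg do rewrite (qform2_local (hp _) gA).
by apply: cvg_sumr => x; apply: cvgMl_tmp; exact: formalH_cvg.
Qed.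

Lemma l2_cvg_pt phi u x : (forall n, l2 m (phi n)) -> l2 m u ->
  << phi n \- u, phi n \- u >> @[n --> \oo] --> 0 -> phi n x @[n --> \oo] --> u x.
Proof.
move=> lp lu h; apply/subr_cvg0.
have : (fun n => << phi n \- u, phi n \- u >> / m x) @ \oo --> 0.
  by rewrite -(mul0r (m x)^-1); exact: cvgMr_tmp.
apply: cvg0_sqr_le => n; rewrite ler_pdivlMr//.
exact: (inner_pt m_gt0 x (l2B m_gt0 (lp n) lu)).
Qed.

(** The form shifted by [K], which by [hK] dominates the squared norm. It is the inner product of
    the form norm. *)
Definition sform f g : R := qform2 f g + K * << f, g >>.

Let cl := @Cc_l2 _ _ _ m_gt0.

Lemma sformC f g : Cc f -> Cc g -> sform f g = sform g f.
Proof. by move=> hf hg; rewrite /sform qform2C// innerC. Qed.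

Lemma sformDl f g h : Cc f -> Cc g -> Cc h -> sform (f \+ g) h = sform f h + sform g h.
Proof. by move=> hf hg hh; rewrite /sform qform2Dl// innerDl//; [ring|exact: cl..]. Qed.

Lemma sformBl f g h : Cc f -> Cc g -> Cc h -> sform (f \- g) h = sform f h - sform g h.
Proof. by move=> hf hg hh; rewrite /sform qform2Bl// innerBl//; [ring|exact: cl..]. Qed.

Lemma sformZl c f h : Cc f -> Cc h -> sform (fun x => c * f x) h = c * sform f h.
Proof. by move=> hf hh; rewrite /sform qform2Zl// innerZl//; [ring|exact: cl..]. Qed.

Lemma sformDr f g h : Cc f -> Cc g -> Cc h -> sform h (f \+ g) = sform h f + sform h g.
Proof. by move=> *; rewrite ![sform h _]sformC ?sformDl//; exact: CcD. Qed.

Lemma sformBr f g h : Cc f -> Cc g -> Cc h -> sform h (f \- g) = sform h f - sform h g.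
Proof. by move=> *; rewrite ![sform h _]sformC ?sformBl//; exact: CcB. Qed.

Lemma sformZr c f h : Cc f -> Cc h -> sform h (fun x => c * f x) = c * sform h f.
Proof. by move=> *; rewrite ![sform h _]sformC ?sformZl//; exact: CcZ. Qed.

Lemma sform_inner f : Cc f -> << f, f >> <= sform f f.
Proof. exact: hK. Qed.

Lemma sform_ge0 f : Cc f -> 0 <= sform f f.
Proof. by move=> hf; apply: le_trans (sform_inner hf); apply/inner_ge0/cl. Qed.

Lemma sformDD f g : Cc f -> Cc g -> sform (f \+ g) (f \+ g) = sform f f + 2 * sform f g + sform g g.
Proof.
move=> hf hg; have hs := CcD hf hg.
by rewrite sformDl// !sformDr// (sformC hg hf); ring.
Qed.

Lemma sformBB f g : Cc f -> Cc g -> sform (f \- g) (f \- g) = sform f f - 2 * sform f g + sform g g.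
Proof.
move=> hf hg; have hs := CcB hf hg.
by rewrite sformBl// !sformBr// (sformC hg hf); ring.
Qed.

Lemma sform_CS f g : Cc f -> Cc g -> sform f g ^+ 2 <= sform f f * sform g g.
Proof.
move=> hf hg; apply: discriminant => t; have hz := CcZ t hg.
have := sform_ge0 (CcD hf hz); rewrite sformDD// sformZr// sformZr// sformZl//.
by rewrite expr2; lra.
Qed.

Lemma sformD_le f g : Cc f -> Cc g -> sform (f \+ g) (f \+ g) <= 2 * sform f f + 2 * sform g g.
Proof.
by move=> hf hg; have := sform_ge0 (CcB hf hg); rewrite sformDD// sformBB//; lra.
Qed.

Lemma innerD_le f g : l2 m f -> l2 m g ->
  << f \+ g, f \+ g >> <= 2 * << f, f >> + 2 * << g, g >>.
Proof.
move=> hf hg; have := inner_ge0 m_gt0 (l2B m_gt0 hf hg).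
by rewrite innerDD// innerBB//; lra.
Qed.

Lemma sform_diff f g : Cc f -> Cc g ->
  (sform f f - sform g g) ^+ 2 <= sform (f \- g) (f \- g) * (2 * sform f f + 2 * sform g g).
Proof.
move=> hf hg; have hs := CcD hf hg; have hd := CcB hf hg.
have -> : sform f f - sform g g = sform (f \- g) (f \+ g).
  by rewrite sformBl// !sformDr// (sformC hg hf); ring.
apply: le_trans (sform_CS hd hs) _; apply: ler_wpM2l; first exact: sform_ge0.
exact: sformD_le.
Qed.

(** * Approximating sequences and closability *)

Definition approx phi u : Prop :=
  [/\ forall n, Cc (phi n), l2 m u,
      << phi n \- u, phi n \- u >> @[n --> \oo] --> 0
    & forall e : R, 0 < e -> exists N : nat, forall n k : nat,
        (N <= n)%N -> (N <= k)%N -> sform (phi n \- phi k) (phi n \- phi k) < e].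

Lemma innerBB_tri f g u : l2 m f -> l2 m g -> l2 m u ->
  << f \- g, f \- g >> <= 2 * << f \- u, f \- u >> + 2 * << g \- u, g \- u >>.
Proof.
move=> hf hg hu; have -> : f \- g = (f \- u) \+ (u \- g) by apply/funext => x /=; ring.
apply: le_trans (innerD_le (l2B m_gt0 hf hu) (l2B m_gt0 hu hg)) _.
by rewrite (innerBB m_gt0 hu hg) (innerBB m_gt0 hg hu) (innerC m g u); lra.
Qed.

(** The Cauchy conditions for the indefinite [qform] and for the nonnegative [sform] differ by [K]
    times the squared norm of [phi n \- phi k], which is small because [phi] converges in l2. *)
Lemma form_approxP phi u : l2 m u -> form_approx b m q phi u <-> approx phi u.
Proof.
move=> lu.
have nE phi' : (forall n, Cc (phi' n)) ->
    (fun n => norm2 m (phi' n \- u)) = (fun n => (<< phi' n \- u, phi' n \- u >>)%:E).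
  by move=> h; apply/funext => n; rewrite inner_norm2//; apply: l2B => //; exact: cl.
have hx e phi' (hc : forall n, Cc (phi' n)) :
    << phi' n \- u, phi' n \- u >> @[n --> \oo] --> 0 -> 0 < e ->
    exists N, forall n k, (N <= n)%N -> (N <= k)%N ->
      `|K * << phi' n \- phi' k, phi' n \- phi' k >>| < e.
  move=> h e0; have e1 : 0 < e / (4 * (`|K| + 1)).
    by rewrite divr_gt0// mulr_gt0// ltr_wpDl.
  have [N hN] := cvg0_lt h e1; exists N => n k Nn Nk.
  have := innerBB_tri (cl (hc n)) (cl (hc k)) lu.
  have h1 := le_lt_trans (ler_norm _) (hN n Nn).
  have h2 := le_lt_trans (ler_norm _) (hN k Nk).
  move=> h3; rewrite normrM (ger0_norm (inner_ge0 _ _))//; last first.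
    by apply: l2B => //; exact: cl.
  have h4 : << phi' n \- phi' k, phi' n \- phi' k >> < e / (`|K| + 1).
    have -> : e / (`|K| + 1) = 4 * (e / (4 * (`|K| + 1))).
      by field; rewrite gt_eqF// ltr_wpDl.
    lra.
  have kp : 0 < `|K| + 1 by rewrite ltr_wpDl.
  move: h4; rewrite ltr_pdivlMr// => h4; apply: le_lt_trans h4.
  rewrite mulrC ler_wpM2l ?lerDl// inner_ge0//; by apply: l2B => //; exact: cl.
split=> -[hc h1 h2].
  have h1' : << phi n \- u, phi n \- u >> @[n --> \oo] --> 0.
    by move: h1; rewrite nE// => /fine_cvgP[_]; exact.
  split => // e e0; have e2 : 0 < e / 2 by lra.
  have [N1 hN1] := h2 _ e2; have [N2 hN2] := hx _ _ hc h1' e2.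
  exists (maxn N1 N2) => n k; rewrite !geq_max => /andP[a1 a2] /andP[c1 c2].
  have := hN1 n k a1 c1; have := hN2 n k a2 c2; rewrite /sform.
  rewrite qform_hb//; last exact: CcB.
  rewrite !ltr_norml; lra.
move=> h3; split => //.
  by rewrite nE//; apply/fine_cvgP; split => //; exact: nearW.
move=> e e0; have e2 : 0 < e / 2 by lra.
have [N1 hN1] := h3 _ e2; have [N2 hN2] := hx _ _ hc h2 e2.
exists (maxn N1 N2) => n k; rewrite !geq_max => /andP[a1 a2] /andP[c1 c2].
have := hN1 n k a1 c1; have := hN2 n k a2 c2.
have := sform_ge0 (CcB (hc n) (hc k)); rewrite /sform.
rewrite qform_hb//; last exact: CcB.
rewrite !ltr_norml; lra.
Qed.

Lemma dom_formP u : dom_form b m q u <-> exists phi, approx phi u.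
Proof.
split=> [[lu [phi /(form_approxP _ lu) h]]|[phi h]]; first by exists phi.
have [_ lu _ _] := h.
by split => //; exists phi; apply/form_approxP.
Qed.

Lemma approxD phi psi u v : approx phi u -> approx psi v ->
  approx (fun n => phi n \+ psi n) (u \+ v).
Proof.
move=> [hc lu h1 h2] [hc' lv h1' h2']; split.
- by move=> n; exact: CcD.
- exact: l2D.
- have : (fun n => 2 * << phi n \- u, phi n \- u >> +
      2 * << psi n \- v, psi n \- v >>) @ \oo --> 0.
    by rewrite -[0]addr0 -(mulr0 2); apply: cvgD; exact: cvgMl_tmp.
  apply: cvg0_le => n.
  have l1 := l2B m_gt0 (cl (hc n)) lu; have l1' := l2B m_gt0 (cl (hc' n)) lv.
  have -> : (phi n \+ psi n) \- (u \+ v) = (phi n \- u) \+ (psi n \- v).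
    by apply/funext => x /=; ring.
  by rewrite inner_ge0 ?innerD_le//; exact: l2D.
- move=> e e0; have e4 : 0 < e / 4 by lra.
  have [N1 hN1] := h2 _ e4; have [N2 hN2] := h2' _ e4.
  exists (maxn N1 N2) => n k; rewrite !geq_max => /andP[a1 a2] /andP[c1 c2].
  have -> : (phi n \+ psi n) \- (phi k \+ psi k) = (phi n \- phi k) \+ (psi n \- psi k).
    by apply/funext => x /=; ring.
  have := sformD_le (CcB (hc n) (hc k)) (CcB (hc' n) (hc' k)).
  have := hN1 n k a1 c1; have := hN2 n k a2 c2; lra.
Qed.

Lemma approxZ c phi u : approx phi u ->
  approx (fun n x => c * phi n x) (fun x => c * u x).
Proof.
move=> [hc lu h1 h2]; split.
- by move=> n; exact: CcZ.
- exact: l2Z.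
- rewrite -(mulr0 (c ^+ 2)); under eq_cvg => n.
    rewrite (_ : _ \- _ = (fun x => c * (phi n \- u) x)); last first.
      by apply/funext => x /=; ring.
    have l1 := l2B m_gt0 (cl (hc n)) lu; have l1' := l2Z m_gt0 c l1.
    rewrite innerZl// innerZr// mulrA -expr2; over.
  exact: cvgMl_tmp.
- move=> e e0; have cp : 0 < c ^+ 2 + 1 by rewrite ltr_wpDl// sqr_ge0.
  have [N hN] := h2 _ (divr_gt0 e0 cp); exists N => n k Nn Nk.
  rewrite (_ : _ \- _ = (fun x => c * (phi n \- phi k) x)); last first.
    by apply/funext => x /=; ring.
  have hd := CcB (hc n) (hc k).
  rewrite sformZl ?sformZr//; last exact: CcZ.
  have := hN n k Nn Nk; rewrite ltr_pdivlMr// => h; apply: le_lt_trans h.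
  by rewrite mulrA -expr2 mulrC ler_wpM2l ?lerDl// sform_ge0.
Qed.

Lemma approxB phi psi u v : approx phi u -> approx psi v ->
  approx (fun n => phi n \- psi n) (u \- v).
Proof.
move=> h1 /(approxZ (-1)) /(approxD h1).
congr approx; first by apply/funext => n; apply/funext => x /=; rewrite mulN1r.
by apply/funext => x /=; rewrite mulN1r.
Qed.

Lemma approx_cst f : Cc f -> approx (fun=> f) f.
Proof.
move=> hf; have z : f \- f = cst 0 by apply/funext => x /=; rewrite subrr.
split => //; first exact: cl.
  by rewrite z inner_cst0; exact: cvg_cst.
move=> e e0; exists 0%N => n k _ _; rewrite z /sform inner_cst0.
have hz := CcB hf hf; have := qform2Bl m_gt0 b_graph b_lf q hf hf hz; rewrite z => ->; lra.
Qed.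

Lemma approx_bounded phi u : approx phi u -> exists C : R, 0 < C /\
  exists N, forall n, (N <= n)%N -> sform (phi n) (phi n) <= C.
Proof.
move=> [hc _ _ h]; have [N hN] := h 1 ltr01.
exists (2 * sform (phi N) (phi N) + 2); split.
  by have := sform_ge0 (hc N); lra.
exists N => n Nn; have := hN n N Nn (leqnn N).
have := sformD_le (hc N) (CcB (hc n) (hc N)).
have -> : phi N \+ (phi n \- phi N) = phi n by apply/funext => x /=; ring.
lra.
Qed.

(* Closability of the form: testing [phi n] against [phi k] for fixed [k] only involves finitely many
   values of [phi n], which tend to 0. *)
Lemma approx0 phi : approx phi (cst 0) -> sform (phi n) (phi n) @[n --> \oo] --> 0.
Proof.
move=> [hc l0 h1 h2]; apply/cvgrPdist_le => e e0.
have [N hN] := h2 _ e0; exists N => // n Nn /=.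
rewrite sub0r normrN ger0_norm ?sform_ge0//; set a := sform _ _.
have [A hA] := (CcP (phi n)).1 (hc n).
have hpt y : phi k y @[k --> \oo] --> (cst 0 : X -> R) y.
  exact: (l2_cvg_pt (fun k => cl (hc k)) l0 h1).
have c1 : qform2 (phi k) (phi n) @[k --> \oo] --> 0.
  have := qform2_cvg hc hA hpt; congr (_ --> _).
  rewrite big1 // => x _; rewrite (formalH_fin m_gt0 b_graph b_lf q _ (fsubset_refl _)).
  by rewrite /= mulr0 mul0r addr0 big1 ?mulr0// => y _; rewrite subrr mulr0.
have c2 : << phi k, phi n >> @[k --> \oo] --> 0.
  have : (fun k => << phi k \- cst 0, phi k \- cst 0 >> * << phi n, phi n >>) @ \oo --> 0.
    by rewrite -[X in _ --> X](mul0r (<< phi n, phi n >>)); exact: cvgMr_tmp.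
  apply: cvg0_sqr_le => k.
  have -> : phi k \- cst 0 = phi k by apply/funext => x /=; rewrite subr0.
  exact: (inner_CS m_gt0 (cl (hc k)) (cl (hc n))).
have c3 : sform (phi k) (phi n) @[k --> \oo] --> 0.
  rewrite -[X in _ --> X](_ : 0 + K * 0 = 0); last by rewrite mulr0 addr0.
  by apply: cvgD => //; exact: cvgMl_tmp.
have a0 : 0 <= a by exact: sform_ge0.
(* Cauchy-Schwarz for [phi n \- phi k] against [phi n] becomes [a ^+ 2 <= e * a] as [k] tends to
   infinity, hence [a <= e]. *)
have c4 : (a - sform (phi k) (phi n)) ^+ 2 @[k --> \oo] --> a ^+ 2.
  have c : a - sform (phi k) (phi n) @[k --> \oo] --> a.
    by rewrite -[X in _ --> X]subr0; apply: cvgB => //; exact: cvg_cst.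
  by rewrite expr2; under eq_cvg do rewrite expr2; exact: cvgM.
have : a ^+ 2 <= e * a.
  apply: (cvgr_to_le c4); exists N => // k Nk /=.
  have hd := CcB (hc n) (hc k).
  rewrite /a -sformBl//; apply: le_trans (sform_CS hd (hc n)) _.
  by apply: ler_wpM2r => //; apply/ltW/hN.
by rewrite expr2; have [->|an] := eqVneq a 0; [lra|rewrite ler_pM2r// lt_neqAle eq_sym an].
Qed.

(** Independence of the limit from the sequence: the difference of two approximating sequences of
    [u] approximates 0, where closability applies. *)
Lemma approx_same phi psi u : approx phi u -> approx psi u ->
  sform (phi n) (phi n) - sform (psi n) (psi n) @[n --> \oo] --> 0.
Proof.
move=> h1 h2; have [C1 [C10 [N1 hN1]]] := approx_bounded h1.
have [C2 [C20 [N2 hN2]]] := approx_bounded h2.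
have [hc1 _ _ _] := h1; have [hc2 _ _ _] := h2.
have /approx0 h0 : approx (fun n => phi n \- psi n) (cst 0).
  have := approxB h1 h2; congr approx; by apply/funext => x /=; rewrite subrr.
apply/cvgrPdist_lt => e e0.
have e1 : 0 < e ^+ 2 / (2 * C1 + 2 * C2) by rewrite divr_gt0 ?exprn_gt0//; lra.
have [N3 hN3] := cvg0_lt h0 e1.
exists (maxn (maxn N1 N2) N3) => // n /=; rewrite !geq_max => /andP[/andP[n1 n2] n3].
rewrite sub0r normrN -(ltr_pXn2r (ltn0Sn 1)) ?nnegrE ?(ltW e0)// real_normK ?num_real//.
apply: le_lt_trans (sform_diff (hc1 n) (hc2 n)) _.
have := hN3 n n3; rewrite ger0_norm; last by apply/sform_ge0/CcB.
rewrite ltr_pdivlMr; last by lra.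
apply: le_lt_trans; apply: ler_wpM2l; first by apply/sform_ge0/CcB.
have := hN1 n n1; have := hN2 n n2; lra.
Qed.

Lemma inner_cvg phi u : (forall n, l2 m (phi n)) -> l2 m u ->
  << phi n \- u, phi n \- u >> @[n --> \oo] --> 0 ->
  << phi n, phi n >> @[n --> \oo] --> << u, u >>.
Proof.
move=> lp lu h.
have c : << phi n \- u, u >> @[n --> \oo] --> 0.
  have : (fun n => << phi n \- u, phi n \- u >> * << u, u >>) @ \oo --> 0.
    by rewrite -(mul0r (<< u, u >>)); exact: cvgMr_tmp.
  by apply: cvg0_sqr_le => n; apply: inner_CS => //; exact: l2B.
rewrite (_ : << u, u >> = 0 + 2 * 0 + << u, u >>); last by ring.
under eq_cvg => n.
  rewrite (_ : << phi n, phi n >> =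
    << phi n \- u, phi n \- u >> + 2 * << phi n \- u, u >> + << u, u >>); last first.
    by rewrite innerBB// innerBl//; ring.
  over.
by apply: cvgD; [apply: cvgD => //; exact: cvgMl_tmp|exact: cvg_cst].
Qed.

Lemma approx_qform_cvg phi u : approx phi u -> cvgn (fun n => qform b m q (phi n)).
Proof.
move=> h; have [C [C0 [N hN]]] := approx_bounded h; have [hc lu h1 h2] := h.
have c1 : cvgn (fun n => sform (phi n) (phi n)).
  apply: cauchy_cvg; apply: cauchy_exP => e e0.
  have e1 : 0 < e ^+ 2 / (4 * C) by rewrite divr_gt0 ?exprn_gt0//; lra.
  have [N2 hN2] := h2 _ e1; pose M := maxn N N2.
  exists (sform (phi M) (phi M)); exists M => // n /= Mn; rewrite /ball /=.
  have [nN nN2] : (N <= n)%N /\ (N2 <= n)%N by move: Mn; rewrite geq_max => /andP[].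
  have MN : (N <= M)%N by exact: leq_maxl.
  have MN2 : (N2 <= M)%N by exact: leq_maxr.
  rewrite -(ltr_pXn2r (ltn0Sn 1)) ?nnegrE ?(ltW e0)// real_normK ?num_real//.
  apply: le_lt_trans (sform_diff (hc M) (hc n)) _.
  have := hN2 M n MN2 nN2; rewrite ltr_pdivlMr; last by lra.
  apply: le_lt_trans; apply: ler_wpM2l; first by apply/sform_ge0/CcB.
  have := hN n nN; have := hN M MN; lra.
have c2 := inner_cvg (fun n => cl (hc n)) lu h1.
apply/cvg_ex; exists (limn (fun n => sform (phi n) (phi n)) - K * << u, u >>).
under eq_cvg => n.
  rewrite (_ : qform b m q (phi n) = sform (phi n) (phi n) - K * << phi n, phi n >>); last first.
    by rewrite qform_hb// /sform; ring.
  over.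
by apply: cvgB => //; exact: cvgMl_tmp.
Qed.

Lemma approx_cform phi u : approx phi u ->
  qform b m q (phi n) @[n --> \oo] --> cform b m q u.
Proof.
move=> h; have [hc lu h1 _] := h.
have cv := approx_qform_cvg h.
(* [xget] returns the limit along some unknown sequence [psi]; [approx_same] carries it over to
   [phi], and the two norm terms have equal limits. *)
rewrite /cform; case: xgetP => [s _ [psi [/(form_approxP _ lu) h' hs]]|]; last first.
  move/(_ (limn (fun n => qform b m q (phi n)))); case; exists phi; split => //.
  exact/form_approxP.
have [hc' _ h1' _] := h'.
have c1 := approx_same h h'.
have c2 := inner_cvg (fun n => cl (hc n)) lu h1.
have c3 := inner_cvg (fun n => cl (hc' n)) lu h1'.
rewrite (_ : s = s + 0 - K * << u, u >> + K * << u, u >>); last by ring.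
under eq_cvg => n.
  rewrite (_ : qform b m q (phi n) = qform b m q (psi n)
    + (sform (phi n) (phi n) - sform (psi n) (psi n))
    - K * << phi n, phi n >> + K * << psi n, psi n >>); last first.
    by rewrite !qform_hb// /sform; ring.
  over.
by apply: cvgD; [apply: cvgB; [exact: cvgD|]|]; exact: cvgMl_tmp.
Qed.

Lemma approx_cform2 phi psi u v : approx phi u -> approx psi v ->
  qform2 (phi n) (psi n) @[n --> \oo] --> cform2 b m q u v.
Proof.
move=> h1 h2; apply: cvgMr_tmp; apply: cvgB.
  exact: approx_cform (approxD h1 h2).
exact: approx_cform (approxB h1 h2).
Qed.

(** * The closed form as a bounded below bilinear form *)

Local Notation D := (dom_form b m q).
Local Notation "u '*h*' v" := (cform2 b m q u v) (at level 40).

Lemma dom_l2 u : D u -> l2 m u. Proof. by case. Qed.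

Lemma domD u v : D u -> D v -> D (u \+ v).
Proof.
move=> /dom_formP[phi h1] /dom_formP[psi h2]; apply/dom_formP.
by eexists; exact: approxD h1 h2.
Qed.

Lemma domB u v : D u -> D v -> D (u \- v).
Proof.
move=> /dom_formP[phi h1] /dom_formP[psi h2]; apply/dom_formP.
by eexists; exact: approxB h1 h2.
Qed.

Lemma domZ c u : D u -> D (fun x => c * u x).
Proof.
by move=> /dom_formP[phi h1]; apply/dom_formP; eexists; exact: approxZ h1.
Qed.

Lemma Cc_dom f : Cc f -> D f.
Proof. by move=> /approx_cst h; apply/dom_formP; eexists; exact: h. Qed.

Lemma cform2_Cc f g : Cc f -> Cc g -> f *h* g = qform2 f g.
Proof.
move=> hf hg; have := approx_cform2 (approx_cst hf) (approx_cst hg) => /cvg_unique.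
by apply => //; exact: cvg_cst.
Qed.

Lemma cform2C u v : D u -> D v -> u *h* v = v *h* u.
Proof.
move=> /dom_formP[phi h1] /dom_formP[psi h2].
have [hc1 _ _ _] := h1; have [hc2 _ _ _] := h2.
have c : qform2 (phi n) (psi n) @[n --> \oo] --> v *h* u.
  by under eq_cvg do rewrite qform2C//; exact: approx_cform2.
exact: (cvg_unique _ (approx_cform2 h1 h2) c).
Qed.

Lemma cform2Dl u v w : D u -> D v -> D w -> (u \+ v) *h* w = u *h* w + v *h* w.
Proof.
move=> /dom_formP[phi h1] /dom_formP[psi h2] /dom_formP[xi h3].
have [hc1 _ _ _] := h1; have [hc2 _ _ _] := h2; have [hc3 _ _ _] := h3.
have c0 : qform2 (phi n \+ psi n) (xi n) @[n --> \oo] --> u *h* w + v *h* w.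
  by under eq_cvg do rewrite qform2Dl//; apply: cvgD; exact: approx_cform2.
exact: (cvg_unique _ (approx_cform2 (approxD h1 h2) h3) c0).
Qed.

Lemma cform2Bl u v w : D u -> D v -> D w -> (u \- v) *h* w = u *h* w - v *h* w.
Proof.
move=> /dom_formP[phi h1] /dom_formP[psi h2] /dom_formP[xi h3].
have [hc1 _ _ _] := h1; have [hc2 _ _ _] := h2; have [hc3 _ _ _] := h3.
have c0 : qform2 (phi n \- psi n) (xi n) @[n --> \oo] --> u *h* w - v *h* w.
  by under eq_cvg do rewrite qform2Bl//; apply: cvgB; exact: approx_cform2.
exact: (cvg_unique _ (approx_cform2 (approxB h1 h2) h3) c0).
Qed.

Lemma cform2Zl c u w : D u -> D w -> (fun x => c * u x) *h* w = c * (u *h* w).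
Proof.
move=> /dom_formP[phi h1] /dom_formP[xi h3].
have [hc1 _ _ _] := h1; have [hc3 _ _ _] := h3.
have c0 : qform2 (fun x => c * phi n x) (xi n) @[n --> \oo] --> c * (u *h* w).
  by under eq_cvg do rewrite qform2Zl//; apply: cvgMl_tmp; exact: approx_cform2.
exact: (cvg_unique _ (approx_cform2 (approxZ c h1) h3) c0).
Qed.

Lemma cform2Dr u v w : D u -> D v -> D w -> w *h* (u \+ v) = w *h* u + w *h* v.
Proof. by move=> *; rewrite ![w *h* _]cform2C ?cform2Dl//; exact: domD. Qed.

Lemma cform2Zr c u w : D u -> D w -> w *h* (fun x => c * u x) = c * (w *h* u).
Proof. by move=> *; rewrite ![w *h* _]cform2C ?cform2Zl//; exact: domZ. Qed.

Lemma cform2_lb u : D u -> << u, u >> <= u *h* u + K * << u, u >>.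
Proof.
move=> /dom_formP[phi h]; have [hc lu h1 _] := h.
have c := inner_cvg (fun n => cl (hc n)) lu h1.
apply: (ler_cvg_to c); last by apply: nearW => n; exact: (sform_inner (hc n)).
by apply: cvgD; [exact: approx_cform2|exact: cvgMl_tmp].
Qed.

End ClosedForm.

(** * Spectrum below the essential spectrum *)

(** Taking the supremum of the admissible lower bounds, instead of the infimum of quotients, avoids
    dividing by a vanishing [n]. The index type is abstract since the lemma serves both for
    functions in the form domain and for pairs of a function and its image under the operator. *)
Lemma rayleigh_inf (R : realType) (T : Type) (I : T -> Prop) (n r : T -> R) (s0 : R) :
  (forall i, I i -> 0 <= n i) -> (forall i, I i -> s0 * n i <= r i) ->
  (exists2 i, I i & 0 < n i) ->
  exists mu, [/\ forall i, I i -> mu * n i <= r i, s0 <= mu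
    & forall e, 0 < e -> exists2 i, I i & r i < (mu + e) * n i].
Proof.
move=> n0 hs0 [i0 Ii0 ni0].
pose P := [set s : R | forall i, I i -> s * n i <= r i].
have Pub i s : I i -> 0 < n i -> P s -> s <= r i / n i.
  by move=> Ii ni /(_ i Ii); rewrite ler_pdivlMr.
have hs : has_sup P.
  by split; [exists s0|exists (r i0 / n i0) => s; exact: Pub].
have subP := sup_upper_bound hs.
have Psup : P (sup P).
  move=> i Ii; have := n0 i Ii; rewrite le_eqVlt => /predU1P[n00|ni].
    by have := hs0 i Ii; rewrite -n00 !mulr0.
  by rewrite -ler_pdivlMr//; apply: ge_sup; [exists s0|move=> s; exact: Pub].
exists (sup P); split => //; first exact: subP.
move=> e e0; apply: contrapT => h.
have /subP : P (sup P + e); last by lra.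
by move=> i Ii; rewrite leNgt; apply/negP => hlt; apply: h; exists i.
Qed.

(** Common end of the two spectral arguments: [n] is the squared norm of a near-minimiser [v], [A]
    its excess over the infimum, and [z] its product with the solution [w] of the inverse problem.
    The last two bounds give [n <= A * sqrt C <= A * C], against the first. *)
Lemma cauchy_schwarz_absurd (R : realFieldType) (n A z C : R) : 1 <= C -> 0 <= n -> 0 <= A ->
  A < C^-1 * n -> n ^+ 2 <= A * z -> z ^+ 2 <= C * n ^+ 2 -> False.
Proof.
move=> C1 n0 A0 An nAz zn; have C0 : 0 < C by lra.
have n1 : 0 < n by rewrite lt_neqAle n0 andbT eq_sym; apply/eqP => n00; move: An; rewrite n00; lra.
have h1 : A * C < n by rewrite -ltr_pdivlMr// mulrC.
have h2 : (A * C) ^+ 2 < n ^+ 2 by rewrite ltr_pXn2r// nnegrE// mulr_ge0// ltW.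
have h3 : n ^+ 2 * n ^+ 2 <= A ^+ 2 * (C * n ^+ 2).
  apply: (@le_trans _ _ ((A * z) ^+ 2)); last by rewrite exprMn ler_wpM2l// sqr_ge0.
  by rewrite -expr2 ler_pXn2r// nnegrE ?exprn_ge0//; apply: le_trans nAz; exact: sqr_ge0.
move: h3; rewrite mulrA ler_pM2r ?exprn_gt0// => h3.
have : A ^+ 2 * C <= (A * C) ^+ 2 by rewrite exprMn ler_wpM2l ?sqr_ge0// expr2 ler_peMl// ltW.
lra.
Qed.

Section Spectral.
Local Notation "c ** f" := (fun x => c * f x) (at level 40).
Context {R : realType} {X : choiceType} (m : X -> R) (b : X -> X -> R) (q : X -> R).
Hypothesis m_gt0 : forall x, 0 < m x.
Hypothesis b_graph : is_graph b.
Hypothesis b_lf : locally_finite b.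
Implicit Types (f g u v w : X -> R).
Variable K : R.
Hypothesis hK : forall f, Cc f -> inner m f f <= qform2 m b q f f + K * inner m f f.

Local Notation "<< f , g >>" := (inner m f g).
Local Notation D := (dom_form b m q).
Local Notation "u '*h*' v" := (cform2 b m q u v) (at level 40).
Local Notation opH := (opH b m q).
Local Notation resolvent := (resolvent_set b m q).
Local Notation spec := (spectrum b m q).

Let domD' u v : D u -> D v -> D (u \+ v).
Proof. exact (@domD _ _ _ _ _ m_gt0 b_graph b_lf _ hK _ _). Qed.
Let domB' u v : D u -> D v -> D (u \- v).
Proof. exact (@domB _ _ _ _ _ m_gt0 b_graph b_lf _ hK _ _). Qed.
Let domZ' c u : D u -> D (c ** u).
Proof. exact (@domZ _ _ _ _ _ m_gt0 b_graph b_lf _ hK _ _). Qed.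
Let hC u v : D u -> D v -> u *h* v = v *h* u.
Proof. exact (@cform2C _ _ _ _ _ m_gt0 b_graph b_lf _ hK _ _). Qed.
Let hDl u v w : D u -> D v -> D w -> (u \+ v) *h* w = u *h* w + v *h* w.
Proof. exact (@cform2Dl _ _ _ _ _ m_gt0 b_graph b_lf _ hK _ _ _). Qed.
Let hBl u v w : D u -> D v -> D w -> (u \- v) *h* w = u *h* w - v *h* w.
Proof. exact (@cform2Bl _ _ _ _ _ m_gt0 b_graph b_lf _ hK _ _ _). Qed.
Let hZl c u w : D u -> D w -> (c ** u) *h* w = c * (u *h* w).
Proof. exact (@cform2Zl _ _ _ _ _ m_gt0 b_graph b_lf _ hK _ _ _). Qed.
Let hDr u v w : D u -> D v -> D w -> w *h* (u \+ v) = w *h* u + w *h* v.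
Proof. exact (@cform2Dr _ _ _ _ _ m_gt0 b_graph b_lf _ hK _ _ _). Qed.
Let hZr c u w : D u -> D w -> w *h* (c ** u) = c * (w *h* u).
Proof. exact (@cform2Zr _ _ _ _ _ m_gt0 b_graph b_lf _ hK _ _ _). Qed.
Let dl2 u : D u -> l2 m u. Proof. exact: dom_l2. Qed.
Let l2D' := @l2D _ _ m m_gt0.
Let l2B' := @l2B _ _ m m_gt0.
Let l2Z' := @l2Z _ _ m m_gt0.
Let iC := @innerC _ _ m.
Let iDl := @innerDl _ _ m m_gt0.
Let iDr := @innerDr _ _ m m_gt0.
Let iBl := @innerBl _ _ m m_gt0.
Let iBr := @innerBr _ _ m m_gt0.
Let iZl := @innerZl _ _ m m_gt0.
Let iZr := @innerZr _ _ m m_gt0.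
Let iCS := @inner_CS _ _ m m_gt0.
Let i0 := @inner_ge0 _ _ m m_gt0.

Local Ltac l2s := repeat first [assumption | apply: dl2; assumption |
  lazymatch goal with
  | |- dom_form _ _ _ (_ \+ _) => apply: domD'
  | |- dom_form _ _ _ (_ \- _) => apply: domB'
  | |- dom_form _ _ _ (fun x => _ * _) => apply: domZ'
  | |- l2 _ (_ \+ _) => apply: l2D'
  | |- l2 _ (_ \- _) => apply: l2B'
  | |- l2 _ (fun x => _ * _) => apply: l2Z'
  end].

Lemma opHD u f v g : opH u f -> opH v g -> opH (u \+ v) (f \+ g).
Proof.
move=> [du lf hu] [dv lg hv]; split; [exact: domD'|exact: l2D'|move=> w dw].
by rewrite hDl// hu// hv// iDl//; exact: dl2.
Qed.

Lemma opHB u f v g : opH u f -> opH v g -> opH (u \- v) (f \- g).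
Proof.
move=> [du lf hu] [dv lg hv]; split; [exact: domB'|exact: l2B'|move=> w dw].
by rewrite hBl// hu// hv// iBl//; exact: dl2.
Qed.

Lemma opHZ c u f : opH u f -> opH (c ** u) (c ** f).
Proof.
move=> [du lf hu]; split; [exact: domZ'|exact: l2Z'|move=> w dw].
by rewrite hZl// hu// iZl//; exact: dl2.
Qed.

Lemma opH_sym u f v g : opH u f -> opH v g -> << f, v >> = << g, u >>.
Proof. by move=> [du lf hu] [dv lg hv]; rewrite -hu// -hv// hC. Qed.

Lemma resolventP s : resolvent s -> exists C : R, 0 < C /\
  (forall u g, opH u g -> << u, u >> <= C * << g \- s ** u, g \- s ** u >>) /\
  forall f, l2 m f -> exists u, opH u (f \+ s ** u).
Proof.
move=> [h1 [C h2]]; exists (`|C| + 1); split; first by rewrite ltr_wpDl.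
split=> [u g hu|f /h1[u [hu _]]]; last by exists u.
have [/dl2 lu lg _] := hu; have := h2 u g hu; rewrite inner_norm2//.
have ld : l2 m (g \- s ** u) by l2s.
rewrite (inner_norm2 m_gt0 ld) -EFinM lee_fin => /le_trans; apply.
by apply: ler_wpM2r; [exact: i0|rewrite ler_wpDr// ler_norm].
Qed.

Lemma notspecP s : ~ spec s -> resolvent s.
Proof. exact: contrapT. Qed.

Lemma eigen_spec nu e : opH e (nu ** e) -> 0 < << e, e >> -> spec nu.
Proof.
move=> he e0 /resolventP[C [C0 [/(_ _ _ he)]]].
rewrite (_ : _ \- _ = cst 0); last by apply/funext => x /=; rewrite subrr.
by rewrite inner_cst0 mulr0; move: e0; lra.
Qed.

(* If [(H - mu) w = v], then the nonnegative form [h - mu] has value [<v, v>] at [(v, w)] and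
   [<v, w>] at [(w, w)], so Cauchy-Schwarz bounds [(h - mu)(v, v)] from below. *)
Lemma bottom_spec (M : set (X -> R)) (mu : R) :
  (forall v, M v -> D v) ->
  (forall t v w, M v -> M w -> M (v \+ t ** w)) ->
  (forall v w, resolvent mu -> M v -> opH w (v \+ mu ** w) -> M w) ->
  (forall v, M v -> mu * << v, v >> <= v *h* v) ->
  (forall e, 0 < e -> exists2 v, M v & v *h* v < (mu + e) * << v, v >>) ->
  spec mu.
Proof.
move=> MD Ml Minv Mlb Map hr; have [C [C0 [qform2 hs]]] := resolventP hr.
have e0 : 0 < (C + 1)^-1 by rewrite invr_gt0; lra.
have [v Mv hv] := Map _ e0; have dv := MD _ Mv; have lv := dl2 dv.
have [w hw] := hs v lv; have Mw := Minv v w hr Mv hw.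
have [dw lz hwv] := hw; have lw := dl2 dw.
have := qform2 _ _ hw; rewrite (_ : (v \+ mu ** w) \- mu ** w = v); last first.
  by apply/funext => x /=; ring.
set n := << v, v >> => hn.
have n0 : 0 < n.
  rewrite lt_neqAle i0// andbT eq_sym; apply/eqP => n00.
  by move: hv (Mlb v Mv); rewrite -/n n00; lra.
have lmw := l2Z' mu lw.
have E1 : v *h* w = n + mu * << v, w >> by rewrite hC// hwv// iDl// iZl// (iC w v).
have E2 : w *h* w = << v, w >> + mu * << w, w >> by rewrite hwv// iDl// iZl.
have cs : n ^+ 2 <= (v *h* v - mu * n) * << v, w >>.
  apply: discriminant => t; have Mt := Ml t v w Mv Mw.
  have := Mlb _ Mt; have dt := domZ' t dw; have lt := dl2 dt.
  have ls := l2D' lv lt; have ds := domD' dv dt.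
  rewrite hDl// !hDr// !hZl// !hZr// iDl// !iDr// !iZl// !iZr//.
  rewrite (hC dw dv) (iC w v) E1 E2 -/n; nra.
have vw : << v, w >> ^+ 2 <= C * n ^+ 2.
  apply: le_trans (iCS lv lw) _; rewrite -/n expr2 mulrCA.
  by apply: ler_wpM2l => //; exact: ltW.
apply: (@cauchy_schwarz_absurd _ n (v *h* v - mu * n) << v, w >> (C + 1)) => //.
- by lra.
- exact: ltW.
- by rewrite subr_ge0; exact: Mlb.
- by move: hv; rewrite -/n; lra.
- by apply: le_trans vw _; rewrite ler_wpM2r ?sqr_ge0//; lra.
Qed.


(* With [rho ^ 2] the infimum of the Rayleigh quotient of [(H - c) ^ 2], factor
   [(H - c) ^ 2 - rho ^ 2 = (H - c - rho) (H - c + rho)] and argue as in [bottom_spec]. *)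
Lemma dist_spec (c delta : R) v g : 0 < delta ->
  (forall t, `|t - c| < delta -> resolvent t) -> opH v g ->
  delta ^+ 2 * << v, v >> <= << g \- c ** v, g \- c ** v >>.
Proof.
move=> d0 hres hv; rewrite leNgt; apply/negP => hlt.
pose r (p : (X -> R) * (X -> R)) := p.2 \- c ** p.1.
have lr p : opH p.1 p.2 -> l2 m p.1 /\ l2 m (r p).
  by move=> [/dl2 lv lg _]; split => //; rewrite /r; l2s.
have [lv lrv] : l2 m v /\ l2 m (g \- c ** v) := lr (v, g) hv.
have v0 : 0 < << v, v >>.
  rewrite lt_neqAle i0// andbT eq_sym; apply/eqP => v0.
  by have := i0 lrv; move: hlt; rewrite v0 mulr0; lra.
have [s [hs s0 hap]] := @rayleigh_inf _ _ (fun p => opH p.1 p.2)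
  (fun p => << p.1, p.1 >>) (fun p => << r p, r p >>) 0
  (fun p hp => i0 (lr p hp).1)
  (fun p hp => eq_ind_r (fun z => z <= _) (i0 (lr p hp).2) (mul0r _))
  (ex_intro2 _ _ (v, g) hv v0).
have sd : s < delta ^+ 2.
  by rewrite -(ltr_pM2r v0); apply: le_lt_trans (hs (v, g) hv) hlt.
pose rho := Num.sqrt s.
have rho2 : rho ^+ 2 = s by rewrite sqr_sqrtr.
have rho0 : 0 <= rho by exact: sqrtr_ge0.
have rhod : rho < delta by rewrite -(ltr_pXn2r (ltn0Sn 1)) ?nnegrE// ?rho2// ltW.
have [C1 [C10 [hb1 hs1]]] : exists C : R, 0 < C /\
  (forall u g, opH u g -> << u, u >> <= C * << g \- (c + rho) ** u, g \- (c + rho) ** u >>) /\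
  forall f, l2 m f -> exists u, opH u (f \+ (c + rho) ** u).
  by apply/resolventP/hres; rewrite addrC addKr ger0_norm.
have [C2 [C20 [hb2 hs2]]] : exists C : R, 0 < C /\
  (forall u g, opH u g -> << u, u >> <= C * << g \- (c - rho) ** u, g \- (c - rho) ** u >>) /\
  forall f, l2 m f -> exists u, opH u (f \+ (c - rho) ** u).
  by apply/resolventP/hres; rewrite addrC addKr normrN ger0_norm.
clear v g hv hlt lv lrv v0.
pose C := C2 * C1 + 1; have C0 : 0 < C by rewrite addr_gt0// mulr_gt0.
have e0 : 0 < C^-1 by rewrite invr_gt0.
have [[v g] /= hv hlt] := hap _ e0.
have [lv lrv] : l2 m v /\ l2 m (g \- c ** v) := lr (v, g) hv.
have lg : l2 m g by case: hv.
(* Here [(H - c - rho) w' = v] and [(H - c + rho) w = w'], so [w] solves [((H - c) ^ 2 - s) w = v].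
   The symmetry relations [E1] to [E3] make the mixed term of the discriminant equal to [n] and the
   quadratic one equal to [<< v, w >>]. *)
have [w' hw'] := hs1 v lv; have lw' : l2 m w' by case: hw' => /dl2.
have [w hw] := hs2 w' lw'; have lw : l2 m w by case: hw => /dl2.
have := hb1 _ _ hw'; rewrite (_ : (_ \+ _) \- _ = v); last first.
  by apply/funext => x /=; ring.
have := hb2 _ _ hw; rewrite (_ : (_ \+ _) \- _ = w'); last first.
  by apply/funext => x /=; ring.
move=> bw bw'.
have l1 := l2Z' (c + rho) lw'; have l2 := l2Z' (c - rho) lw.
have E1 : << g, w' >> = << v, v >> + (c + rho) * << w', v >>.
  by rewrite (opH_sym hv hw') iDl// iZl.
have E2 : << g, w >> = << w', v >> + (c - rho) * << w, v >>.
  by rewrite (opH_sym hv hw) iDl// iZl.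
have E3 : << v, w >> + (c + rho) * << w', w >> = << w', w' >> + (c - rho) * << w, w' >>.
  by have := opH_sym hw' hw; rewrite !iDl// !iZl.
set n := << v, v >> in E1 bw' hlt *.
have cs : n ^+ 2 <= (<< g \- c ** v, g \- c ** v >> - s * n) * << v, w >>.
  apply: discriminant => t; pose k := w' \+ (c - rho) ** w.
  have lk : Defs.l2 m k by rewrite /k; l2s.
  have lcv := l2Z' c lv; have lcw := l2Z' c lw; have ltw := l2Z' t lw.
  have lkw := l2B' lk lcw; have ltk := l2Z' t lkw.
  have := hs (v \+ t ** w, g \+ t ** k) (opHD hv (opHZ t hw)).
  rewrite /r /= (_ : (g \+ t ** k) \- c ** (v \+ t ** w) =
     (g \- c ** v) \+ t ** (k \- c ** w)); last by apply/funext => x /=; ring.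
  rewrite (innerDD m_gt0 lv ltw) (innerDD m_gt0 lrv ltk).
  rewrite (iZr t lw lv) (iZr t lkw lrv) (iZl t lw ltw) (iZr t lw lw).
  rewrite (iZl t lkw ltk) (iZr t lkw lkw).
  rewrite (_ : k \- c ** w = w' \- rho ** w); last by apply/funext => x; rewrite /k /=; ring.
  have lrw := l2Z' rho lw.
  rewrite (innerBB m_gt0 lw' lrw) (iBr lw' lrw lrv) (iZr rho lw lrv) (iBl lg lcv lw').
  rewrite (iBl lg lcv lw) (iZl c lv lw) (iZl c lv lw') E1 E2 (iZr rho lw lw') (iZl rho lw lrw).
  rewrite (iZr rho lw lw) -/n -rho2 (iC v w) (iC v w').
  move: E3; rewrite (iC v w) (iC w w') => E3.
  have -> : << w, v >> = << w', w' >> - 2 * rho * << w', w >> by lra.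
  set Q := << g \- _, _ >>; move=> h; rewrite -subr_ge0 in h.
  by apply: le_trans h _; rewrite le_eqVlt; apply/orP; left; apply/eqP; ring.
set Q := << g \- _, _ >> in cs hlt.
have sQ : s * n <= Q by exact: (hs (v, g) hv).
have n0 : 0 <= n by exact: i0.
apply: (@cauchy_schwarz_absurd _ n (Q - s * n) << v, w >> C) => //.
- by rewrite /C lerDr mulr_ge0 ?ltW.
- by lra.
- by lra.
apply: le_trans (iCS lv lw) _; rewrite -/n expr2 mulrCA; apply: ler_wpM2l => //.
apply: le_trans bw _; apply: le_trans (ler_wpM2l (ltW C20) bw') _.
by rewrite mulrA /C mulrDl mul1r lerDl.
Qed.


(* [dist_spec] at the midpoint of the gap above [mu]. *)
Lemma isolated_spec mu (e : R) v g : 0 < e ->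
  (forall t, spec t -> `|t - mu| < e -> t = mu) -> opH v g ->
  e * << g \- mu ** v, v >> <= << g \- mu ** v, g \- mu ** v >>.
Proof.
move=> e0 iso hv; have [/dl2 lv lg _] := hv.
have e2 : 0 < e / 2 by lra.
(* The gap above [mu] has centre [mu + e / 2] and radius [e / 2]. Expanding the square cancels the
   two terms [(e / 2) ^+ 2 * << v, v >>]; for a number [t] this says that [t ^ 2 >= e * t] outside
   the interval from 0 to [e]. *)
have : (e / 2) ^+ 2 * << v, v >> <=
    << g \- (mu + e / 2) ** v, g \- (mu + e / 2) ** v >>.
  apply: dist_spec => // t; rewrite ltr_distlC => /andP[h1 h2]; apply: notspecP => st.
  have : t = mu by apply: iso => //; rewrite ltr_norml; lra.
  lra.
have lr : l2 m (g \- mu ** v) by l2s.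
have lev := l2Z' (e / 2) lv.
rewrite (_ : g \- (mu + e / 2) ** v = (g \- mu ** v) \- (e / 2) ** v); last first.
  by apply/funext => x /=; ring.
rewrite (innerBB m_gt0 lr lev) (iZr _ lv lr) (iZr _ lv lev) (iZl _ lv lv); nra.
Qed.

(* Lists of pairs (eigenvalue, eigenfunction). *)
Fixpoint perp (F : seq (R * (X -> R))) v : Prop :=
  if F is p :: F' then << v, p.2 >> = 0 /\ perp F' v else True.

Fixpoint eigen_chain (F : seq (R * (X -> R))) : Prop :=
  if F is p :: F' then
    [/\ eigen_chain F', opH p.2 (p.1 ** p.2), << p.2, p.2 >> = 1 & perp F' p.2]
  else True.

Lemma perp_lin F t v w : eigen_chain F -> l2 m v -> l2 m w -> perp F v -> perp F w ->
  perp F (v \+ t ** w).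
Proof.
elim: F => //= p F IH [/IH{}IH [/dl2 lp _ _] _ _] lv lw [v0 /IH{}IH] [w0 /IH{}IH].
split; last by apply: IH.
have ltw := l2Z' t lw.
by rewrite (iDl lv ltw lp) (iZl t lw lp) v0 w0 mulr0 addr0.
Qed.

(** Symmetry gives [(p.1 - s) * << p.2, w >> = << v, p.2 >> = 0], and [p.1] differs from [s] because
    an eigenvalue is not in the resolvent set. *)
Lemma perp_resolvent F s v w : eigen_chain F -> resolvent s -> l2 m v -> perp F v ->
  opH w (v \+ s ** w) -> perp F w.
Proof.
move=> + rs lv + hw; elim: F => //= p F IH [cF hp p1 _] [v0 /(IH cF) pF]; split => //.
have [/dl2 lw _ _] := hw; have [/dl2 lp _ _] := hp; have lsw := l2Z' s lw.
have := opH_sym hp hw; rewrite (iZl _ lp lw) (iDl lv lsw lp) (iZl s lw lp) v0 add0r.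
rewrite (iC p.2 w) => /eqP; rewrite -subr_eq0 -mulrBl mulf_eq0 => /orP[|/eqP//].
rewrite subr_eq0 => /eqP ps; exfalso.
have : spec p.1 by apply: (eigen_spec hp); rewrite p1.
by rewrite ps; exact.
Qed.

Lemma perp_closed F (x : nat -> X -> R) y : eigen_chain F -> (forall n, l2 m (x n)) -> l2 m y ->
  (forall e : R, 0 < e -> exists n, << x n \- y, x n \- y >> <= e) ->
  (forall n, perp F (x n)) -> perp F y.
Proof.
move=> + lx ly cv; elim: F => //= p F IH [/IH{}IH hp p1 _] hF; split; last first.
  by apply: IH => n; have [] := hF n.
have [/dl2 lp _ _] := hp.
apply/eqP; rewrite -sqrf_eq0 eq_le sqr_ge0 andbT; apply/ler_addgt0Pl => e e0.
have [n hn] := cv e e0; have [xn0 _] := hF n.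
have lb := l2B' (lx n) ly.
rewrite addr0; apply: le_trans hn; have := iCS lb lp.
by rewrite (iBl (lx n) ly lp) xn0 sub0r sqrrN p1 mulr1.
Qed.

(* The proximal iteration [x_(n+1) = (e/2) (H - mu + e/2)^-1 x_n] contracts the energy
   [h - mu] geometrically, by [isolated_spec], and so converges to an eigenfunction. *)
Lemma isolated_eigen F mu e : 0 < e ->
  (forall t, spec t -> `|t - mu| < e -> t = mu) -> eigen_chain F ->
  (forall v, D v -> perp F v -> mu * << v, v >> <= v *h* v) ->
  (forall r, 0 < r -> exists2 v, D v /\ perp F v & v *h* v < (mu + r) * << v, v >>) ->
  exists x, [/\ perp F x, opH x (mu ** x) & 0 < << x, x >>].
Proof.
(* With [k = e / 2] the point [mu - k] lies in the isolating interval, hence in the resolvent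
   set. *)
move=> e0 iso cF lb ap; pose k := e / 2; have k0 : 0 < k by rewrite /k; lra.
have rk : resolvent (mu - k).
  apply: notspecP => /iso h; have : mu - k = mu.
    by apply: h; rewrite addrC addKr normrN ger0_norm /k; lra.
  lra.
have [C [C0 [qform2 hs]]] := resolventP rk.
(* [T] is [k (H - mu + k)^-1] on l2, and the identity elsewhere as a default. *)
have [T hT] : {T : (X -> R) -> X -> R &
    forall f, l2 m f -> opH (T f) ((k ** f) \+ (mu - k) ** T f)}.
  apply: (@choice _ _ (fun f u => l2 m f -> opH u ((k ** f) \+ (mu - k) ** u))) => f.
  have [lf|nlf] := pselect (l2 m f); last by exists f.
  by have [u hu] := hs _ (l2Z' k lf); exists u.
(* The iteration moves [x0] by at most [4 * c] in squared norm, where [c] is less than a 32nd of the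
   squared norm of [x0]. This is what keeps the limit away from 0. *)
have e32 : 0 < e / 32 by lra.
have [x0 [dx0 px0] hx0] := ap _ e32.
pose x n := iter n T x0.
pose a v := v *h* v - mu * << v, v >>.
pose d n := x n \- x n.+1.
have dx n : D (x n) /\ perp F (x n).
  elim: n => [//|n [dn pn]]; have ln := dl2 dn; have h := hT _ ln.
  split; first by case: h.
  apply: (perp_resolvent cF rk (l2Z' k ln) _ h).
  have := perp_lin (k - 1) cF ln ln pn pn; congr (perp F _).
  by apply/funext => p /=; ring.
have lx n : l2 m (x n) by exact/dl2/(dx n).1.
have hx n : opH (x n.+1) ((k ** x n) \+ (mu - k) ** x n.+1) by exact: hT.
have dd n : D (d n) by apply: domB'; [exact: (dx n).1|exact: (dx n.+1).1].
have ld n : l2 m (d n) by exact: dl2.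
have pd n : perp F (d n).
  have := perp_lin (-1) cF (lx n) (lx n.+1) (dx n).2 (dx n.+1).2; congr (perp F _).
  by apply/funext => p /=; rewrite /d /=; ring.
have hd n v : D v -> x n.+1 *h* v = k * << d n, v >> + mu * << x n.+1, v >>.
  move=> dv; have [_ _ ->//] := hx n; have lv := dl2 dv.
  rewrite (iDl (l2Z' k (lx n)) (l2Z' (mu - k) (lx n.+1)) lv) !iZl//.
  by rewrite /d iBl//; ring.
have a0 v : D v -> perp F v -> 0 <= a v by move=> dv pv; rewrite subr_ge0; exact: lb.
have step n : a (x n) = a (x n.+1) + 2 * k * << d n, d n >> + a (d n).
  have E : x n = x n.+1 \+ d n by apply/funext => p; rewrite /d /=; ring.
  have d1 := (dx n.+1).1; have d2 := dd n.
  have d3 : D (x n.+1 \+ d n) by rewrite -E; exact: (dx n).1.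
  rewrite /a {1 2 3 4}E (hDl d1 d2 d3) (hDr d1 d2 d1) (hDr d1 d2 d2) (hC d2 d1).
  by rewrite (hd n (d n) d2) (innerDD m_gt0 (lx n.+1) (ld n)); ring.
(* Since [(H - mu) x_(n+1) = k d_n], [isolated_spec] reads [e * k * << d n, x n.+1 >> <= k ^+ 2 * <<
   d n, d n >>], while [a (x n.+1)] is [k * << d n, x n.+1 >>]; then insert [k = e / 2]. *)
have pl n : 4 * a (x n.+1) <= e * << d n, d n >>.
  have := isolated_spec e0 iso (hx n).
  rewrite (_ : _ \- _ = k ** d n); last by apply/funext => p; rewrite /d /=; ring.
  rewrite !iZl// ?iZr//; last exact: l2Z'.
  have -> : a (x n.+1) = k * << d n, x n.+1 >>.
    by rewrite /a hd//; [ring|exact: (dx n.+1).1].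
  rewrite /k; set z := << _, _ >>; set y := << _, _ >>; nra.
have dec n : 4 * a (x n.+1) <= a (x n) /\ e * << d n, d n >> <= a (x n).
  have h1 := step n; have h2 := pl n; have h3 := a0 _ (dd n) (pd n).
  have h4 := a0 _ (dx n.+1).1 (dx n.+1).2.
  have -> : a (x n) = a (x n.+1) + e * << d n, d n >> + a (d n) by rewrite h1 /k; field.
  lra.
pose c := a x0 / e.
have c0 : 0 <= c by rewrite divr_ge0 ?(ltW e0)//; exact: a0.
have geo n : a (x n) <= e * c / 4 ^+ n.
  elim: n => [|n IH]; first by rewrite expr0 divr1 mulrCA divff ?mulr1// gt_eqF.
  have [h _] := dec n; rewrite exprS invfM [4^-1 * _]mulrC mulrA; lra.
have dgeo n : << d n, d n >> <= c / 4 ^+ n.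
  have [_ h] := dec n; rewrite -(ler_pM2l e0) mulrA; exact: le_trans h (geo n).
(* Each splitting costs the factor 2 of [innerD_le], which the ratio 1/4 absorbs:
   [2 * c + 2 * (4 * c) / 4 = 4 * c]. *)
have xgeo j n : << x n \- x (n + j)%N, x n \- x (n + j)%N >> <= 4 * c / 4 ^+ n.
  elim: j n => [|j IH] n.
    rewrite addn0 (_ : _ \- _ = cst 0); last by apply/funext => p /=; ring.
    by rewrite inner_cst0; apply: divr_ge0; [exact: mulr_ge0|exact: exprn_ge0].
  rewrite addnS -addSn (_ : _ \- _ = d n \+ (x n.+1 \- x (n.+1 + j)%N)); last first.
    by apply/funext => p; rewrite /d /=; ring.
  have lb' := l2B' (lx n.+1) (lx (n.+1 + j)%N).
  apply: le_trans (innerD_le m_gt0 (ld n) lb') _.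
  have := IH n.+1; have := dgeo n; rewrite exprS invfM.
  have : 0 <= c / 4 ^+ n by apply: divr_ge0 => //; exact: exprn_ge0.
  have -> : 4 * c * (4^-1 * (4 ^+ n)^-1) = c / 4 ^+ n by field; rewrite expf_neq0.
  rewrite -(mulrA 4 c); lra.
have small r : 0 < r -> exists N, 16 * c / 4 ^+ N <= r.
  move=> r0; have := archi_boundP (divr_ge0 (mulr_ge0 (ler0n R 16) c0) (ltW r0)).
  set N := Num.bound _ => hN; exists N.
  rewrite ler_pdivrMr ?exprn_gt0// [r * _]mulrC -ler_pdivrMr//.
  apply: le_trans (ltW hN) _; rewrite -natrX ler_nat; exact/ltnW/ltn_expl.
have cau r : 0 < r -> exists N, forall n j, (N <= n)%N -> (N <= j)%N ->
    << x n \- x j, x n \- x j >> <= r.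
  move=> /small[N hN]; exists N => n j Nn Nj.
  have := innerBB_tri m_gt0 (lx n) (lx j) (lx N).
  rewrite (innerBC m (x n) (x N)) (innerBC m (x j) (x N)).
  have := xgeo (n - N)%N N; have := xgeo (j - N)%N N; rewrite !subnKC//.
  by move: hN; set z := 4 ^+ N; rewrite -!(mulrA _ c); lra.
have [y [ly hy]] := l2_complete m_gt0 lx cau.
(* [T] is bounded on l2, so [T y] is the limit of [T (x n) = x n.+1]. A fixed point satisfies
   [H y = k y + (mu - k) y = mu y]. *)
have Ty : T y = y.
  have hTy := hT y ly; have lT : l2 m (T y) by case: hTy => /dl2.
  suff z : << T y \- y, T y \- y >> = 0.
    have := inner_eq0 m_gt0 (l2B' lT ly) z => /funeqP h.
    by apply/funext => p; have := h p => /= /eqP; rewrite subr_eq0 => /eqP.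
  apply/eqP; rewrite eq_le i0 ?andbT//; last exact: l2B'.
  apply/ler_addgt0Pl => r r0; rewrite addr0.
  pose w := 2 * (C * k ^+ 2) + 2; have w0 : 0 < w.
    by rewrite /w ltr_wpDl// mulr_ge0// mulr_ge0 ?sqr_ge0// ltW.
  have [N hN] := hy _ (divr_gt0 r0 w0).
  have lTN : l2 m (T y) by [].
  have := innerBB_tri m_gt0 lTN ly (lx N.+1).
  move=> /le_trans; apply; rewrite (innerBC m y).
  have := qform2 _ _ (opHB hTy (hx N)).
  rewrite (_ : _ \- (mu - k) ** _ = (- k) ** (x N \- y)); last by apply/funext => p /=; ring.
  have lb' := l2B' (lx N) ly; rewrite (iZl _ lb' (l2Z' _ lb')) (iZr _ lb' lb').
  have := hN N (leqnn N); have := hN N.+1 (leqnSn N).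
  set z1 := << _, _ >>; set z2 := << _, _ >>; set z3 := << _, _ >> => h1 h2 h3.
  have h4 : 2 * z3 <= 2 * (C * k ^+ 2) * (r / w).
    have h5 : C * k ^+ 2 * z2 <= C * k ^+ 2 * (r / w).
      by apply: ler_wpM2l => //; apply: mulr_ge0; [exact: ltW|exact: sqr_ge0].
    rewrite -mulrA ler_pM2l//; apply: le_trans h3 _; apply: le_trans h5.
    by rewrite le_eqVlt; apply/orP; left; apply/eqP; ring.
  have : w * (r / w) = r by rewrite mulrCA divff ?mulr1// gt_eqF.
  by rewrite {1}/w mulrDl; lra.
exists y; split.
- apply: (perp_closed cF lx ly) => [r r0|n]; last exact: (dx n).2.
  by have [N hN] := hy r r0; exists N; exact: hN.
- have := hT y ly; rewrite Ty; congr opH; apply/funext => p /=; ring.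
- rewrite lt_neqAle i0// andbT eq_sym; apply/eqP => y0.
  have yz := inner_eq0 m_gt0 ly y0.
  have n0 : 0 < << x0, x0 >>.
    have := a0 _ dx0 px0; rewrite /a; move: hx0.
    have := i0 (lx 0%N); rewrite /x /=; set n := << _, _ >> => n0 h1 h2.
    by rewrite lt_neqAle n0 andbT eq_sym; apply/eqP => n00; move: h1 h2; rewrite n00; lra.
  have n8 : 0 < << x0, x0 >> / 8 by lra.
  have [N hN] := hy _ n8; have := hN N (leqnn N).
  have := xgeo N 0%N; rewrite add0n expr0 divr1.
  have := innerBB_tri m_gt0 (lx 0%N) ly (lx N).
  rewrite (innerBC m y (x N)).
  rewrite (_ : x 0%N \- y = x0); last by rewrite yz; apply/funext => p /=; rewrite subr0.
  have : c < << x0, x0 >> / 32.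
    by rewrite /c ltr_pdivrMr// /a; move: hx0; set n := << _, _ >>; lra.
  set z1 := << _, _ >>; set z2 := << _, _ >>; set z3 := << _, _ >>; lra.
Qed.

(** * Finitely many eigenfunctions below the essential spectrum *)

Lemma spec_discrete s : spec s -> (s%:E < lambda0_ess b m q)%E -> discrete_spectrum b m q s.
Proof.
move=> hs hlt; apply: contrapT => hd; move: hlt; rewrite ltNge => /negP; apply.
by apply: ereal_inf_lbound; exists s.
Qed.

Lemma inner_sum (n : nat) (a : 'I_n -> R) (e : 'I_n -> X -> R) g :
  (forall i, l2 m (e i)) -> l2 m g ->
  << (fun x => \sum_(i < n) a i * e i x), g >> = \sum_(i < n) a i * << e i, g >>.
Proof.
move=> le lg.
suff : l2 m (fun x => \sum_(i < n) a i * e i x) /\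
  << (fun x => \sum_(i < n) a i * e i x), g >> = \sum_(i < n) a i * << e i, g >> by case.
elim: (index_enum _) => [|i r [IH1 IH2]].
  under eq_fun do rewrite big_nil.
  by rewrite big_nil inner_cst0; split => //; exact: l2_cst0.
have -> : (fun x => \sum_(j <- i :: r) a j * e j x) =
    a i ** e i \+ (fun x => \sum_(j <- r) a j * e j x).
  by apply/funext => x /=; rewrite big_cons.
have li := l2Z' (a i) (le i); split; first exact: l2D'.
by rewrite big_cons (iDl li IH1 lg) IH2 (iZl _ (le i) lg).
Qed.

(** The coefficients of [k.+1] of these functions in [k] generators form a matrix with a nonzero
    left kernel vector. Pairing the resulting relation with one [e j] isolates a coefficient that
    was chosen nonzero. *)
Lemma orthonormal_not_finite_dim (E : set (X -> R)) (e : nat -> X -> R) :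
  (forall i, E (e i)) -> (forall i, l2 m (e i)) ->
  (forall i j, << e i, e j >> = (i == j)%:R) -> ~ finite_dim E.
Proof.
move=> Ee le orth [k [v hv]].
have [c hc] : {c : nat -> 'I_k -> R & forall i x, e i x = \sum_(j < k) c i j * v j x}.
  by apply: (@choice _ _ (fun i c => forall x, e i x = \sum_(j < k) c j * v j x)) => i; exact: hv.
pose A : 'M[R]_(k.+1, k) := \matrix_(i, j) c i j.
have : kermx A != 0.
  by rewrite kermx_eq0 -row_leq_rank -ltnNge ltnS rank_leq_col.
move/rowV0Pn => [a /sub_kermxP aA /rV0Pn[j aj]].
pose f x := \sum_(i < k.+1) a 0 i * e i x.
have f0 : f = cst 0.
  apply/funext => x; rewrite /f /=.
  under eq_bigr do rewrite hc mulr_sumr.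
  rewrite exchange_big big1 //= => l _.
  transitivity ((\sum_(i < k.+1) a 0 i * c i l) * v l x).
    by rewrite mulr_suml; apply: eq_bigr => i _; rewrite mulrA.
  have := congr1 (fun M : 'rV_k => M 0 l) aA; rewrite !mxE => h.
  rewrite [X in X * _](_ : _ = 0) ?mul0r// -[RHS]h.
  by apply: eq_bigr => i _; rewrite mxE.
have := inner_sum (fun i => a 0 i) (fun i : 'I_k.+1 => le i) (le j).
rewrite -/f f0 inner_cst0 (bigD1 j)//= orth eqxx mulr1 big1 ?addr0.
  by move=> /esym/eqP; apply/negP.
by move=> i ij; rewrite orth (inj_eq val_inj) (negbTE ij) mulr0.
Qed.

Lemma next_eigen F lam : eigen_chain F -> (lam%:E < lambda0_ess b m q)%E ->
  ~ (forall v, D v -> perp F v -> lam * << v, v >> <= v *h* v) ->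
  exists p, [/\ p.1 < lam, eigen_chain (p :: F)
    & forall v, D v -> perp F v -> p.1 * << v, v >> <= v *h* v].
Proof.
move=> cF hlam hn.
have [v [dv pv hv]] : exists v, [/\ D v, perp F v & v *h* v < lam * << v, v >>].
  apply: contrapT => h; apply: hn => v dv pv; rewrite leNgt; apply/negP => hv.
  by apply: h; exists v.
have lb v' : D v' -> (1 - K) * << v', v' >> <= v' *h* v'.
  by move=> dv'; have := cform2_lb m_gt0 b_graph b_lf hK dv'; lra.
have v0 : 0 < << v, v >>.
  rewrite lt_neqAle (i0 (dl2 dv)) andbT eq_sym; apply/eqP => v0.
  by have := lb _ dv; move: hv; rewrite v0; lra.
have [mu [h1 h2 h3]] := @rayleigh_inf _ _ (fun v => D v /\ perp F v)
  (fun v => << v, v >>) (fun v => v *h* v) (1 - K)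
  (fun v h => i0 (dl2 h.1)) (fun v h => lb v h.1) (ex_intro2 _ _ v (conj dv pv) v0).
have mul : mu < lam.
  by rewrite -(ltr_pM2r v0); apply: le_lt_trans hv; exact: h1.
have smu : spec mu.
  apply: (@bottom_spec (fun v => D v /\ perp F v)) => //.
  - by move=> ? [].
  - move=> t u w [du pu] [dw pw]; split; first exact/domD'/domZ'.
    by apply: perp_lin => //; exact: dl2.
  - move=> u w r [du pu] hw; split; first by case: hw.
    by apply: (perp_resolvent cF r (dl2 du) pu hw).
have dmu : discrete_spectrum b m q mu.
  by apply: spec_discrete => //; apply: lt_trans hlam; rewrite lte_fin.
have [_ [e e0 iso] _ _] := dmu.
(* The eigenfunction that comes with [discrete_spectrum] may already lie in the span of [F], so one
   orthogonal to [F] is produced from the isolation of [mu]. *)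
have [x [px hx x0]] := isolated_eigen e0 iso cF (fun v dv pv => h1 v (conj dv pv)) h3.
have [dx _ _] := hx; have lx := dl2 dx.
pose c := (Num.sqrt << x, x >>)^-1.
exists (mu, c ** x); split => //=; last by move=> w dw pw; apply: h1.
split => //.
- have := opHZ c hx; congr (opH _ _); apply/funext => p /=; ring.
- rewrite (iZl c lx (l2Z' c lx)) (iZr c lx lx) mulrA -expr2 exprVn sqr_sqrtr ?ltW//.
  by rewrite mulVf// gt_eqF.
- have := perp_lin (c - 1) cF lx lx px px; congr (perp F _); apply/funext => p /=; ring.
Qed.

Lemma finite_eigen_chain lam : (lam%:E < lambda0_ess b m q)%E ->
  exists2 F, eigen_chain F & forall v, D v -> perp F v -> lam * << v, v >> <= v *h* v.
Proof.
move=> hlam; apply: contrapT => hn.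
have [next hnext] : {next : seq (R * (X -> R)) -> R * (X -> R) & forall F, eigen_chain F ->
    [/\ (next F).1 < lam, eigen_chain (next F :: F)
    & forall v, D v -> perp F v -> (next F).1 * << v, v >> <= v *h* v]}.
  apply: (@choice _ _ (fun F p => eigen_chain F -> [/\ p.1 < lam, eigen_chain (p :: F)
    & forall v, D v -> perp F v -> p.1 * << v, v >> <= v *h* v])) => F.
  have [cF|ncF] := pselect (eigen_chain F); last by exists (0, cst 0).
  have [|p hp] := next_eigen cF hlam _; last by exists p.
  by move=> h; apply: hn; exists F.
pose Fs n := iter n (fun F => next F :: F) [::].
have cF n : eigen_chain (Fs n) by elim: n => [//|n /hnext[]].
pose nu n := (next (Fs n)).1; pose e n := (next (Fs n)).2.
have he n : [/\ opH (e n) (nu n ** e n), << e n, e n >> = 1 & perp (Fs n) (e n)].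
  by have [_ [_ ? ? ?] _] := hnext _ (cF n).
have de n : D (e n) by have [[]] := he n.
have le n : l2 m (e n) by exact/dl2.
have heig n : e n *h* e n = nu n by have [[_ _ h] h1 _] := he n; rewrite h// iZl// h1 mulr1.
have nu_lam n : nu n < lam by have [] := hnext _ (cF n).
(* The next eigenfunction is orthogonal to the shorter chain as well, hence a competitor in the
   previous minimisation. *)
have nuS n : nu n <= nu n.+1.
  have [_ _ h] := hnext _ (cF n); have [_ h1 [_ h2]] := he n.+1.
  by have := h _ (de n.+1) h2; rewrite heig h1 mulr1.
have nnu : {homo nu : n k / (n <= k)%N >-> n <= k} by apply/nondecreasing_seqP.
have ubnu : has_ubound (range nu) by exists lam => _ [n _ <-]; exact/ltW.
have cnu : nu @ \oo --> limn nu.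
  by apply: nondecreasing_is_cvgn => //.
set l := limn nu in cnu.
have ll : l <= lam by apply: (cvgr_to_le cnu); apply: nearW => n; exact/ltW.
have perp_e j v : perp (Fs j) v -> forall i, (i < j)%N -> << v, e i >> = 0.
  elim: j => // j IH [h /IH{}IH] i; rewrite ltnS leq_eqVlt => /predU1P[->//|].
  exact: IH.
have orth i j : << e i, e j >> = (i == j)%:R.
  have [ij|ji|->] := ltngtP i j; last by have [_ ->] := he j.
    by rewrite iC; have [_ _ h] := he j; rewrite (perp_e _ _ h).
  by have [_ _ h] := he i; rewrite (perp_e _ _ h).
have nul r : 0 < r -> exists N, forall n, (N <= n)%N -> `|nu n - l| < r.
  move=> r0; have /cvgrPdist_lt/(_ r r0)[N _ hN] := cnu.
  by exists N => n Nn; rewrite distrC; exact: hN.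
(* The [e n] form a Weyl sequence: [(H - l) e n] has norm [|nu n - l|], which excludes a bounded
   inverse. *)
have sl : spec l.
  move=> /resolventP[C [C0 [hbd _]]].
  have r0 : 0 < (C + 1)^-1 by rewrite invr_gt0; lra.
  have [N /(_ N (leqnn N)) hN] := nul _ r0.
  have [h1 h2 _] := he N; have := hbd _ _ h1; rewrite h2.
  rewrite (_ : _ \- _ = (nu N - l) ** e N); last by apply/funext => p /=; ring.
  have ln := le N; rewrite (iZl _ ln (l2Z' _ ln)) (iZr _ ln ln) h2 mulr1 -expr2.
  have : (nu N - l) ^+ 2 < (C + 1)^-1 ^+ 2.
    by rewrite -(real_normK (num_real (nu N - l))) ltr_pXn2r// nnegrE ltW.
  move=> h3 h4; have : C * (nu N - l) ^+ 2 < C * (C + 1)^-1 ^+ 2 by rewrite ltr_pM2l.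
  have : C * (C + 1)^-1 ^+ 2 < 1.
    have cp : 0 < C + 1 by lra.
    by rewrite exprVn ltr_pdivrMr ?exprn_gt0// mul1r; nra.
  lra.
have : discrete_spectrum b m q l.
  by apply: spec_discrete => //; apply: le_lt_trans hlam; rewrite lee_fin.
(* As [l] is isolated, [nu n] equals [l] from [N] on, which puts infinitely many orthonormal
   functions into one eigenspace of finite dimension. *)
move=> [_ [r r0 iso] _]; have [N hN] := nul _ r0.
apply: (@orthonormal_not_finite_dim _ (fun i => e (N + i)%N)) => //.
- move=> i; have [h1 h2 _] := he (N + i)%N.
  have <- : nu (N + i)%N = l => //.
  apply: iso; last by apply: hN; exact: leq_addr.
  by apply: (eigen_spec h1); rewrite h2.
- by move=> i j; rewrite orth eqn_add2l.
Qed.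

(** * Trading orthogonality to eigenfunctions for vanishing on a finite set *)

Definition penalty (lam : R) (G : seq (R * (X -> R))) v : R :=
  \sum_(p <- G) (lam - p.1) * << v, p.2 >> ^+ 2.

(** The orthogonality constraints are removed one at a time. Subtracting from [v] its component
    along an eigenfunction splits both the form and the norm orthogonally, and the defect is exactly
    one further penalty term. The invariant that [G] is orthogonal to the rest of [F] keeps the old
    terms unchanged. *)
Lemma chain_penalty lam F G : eigen_chain F ->
  (forall p, List.In p G -> l2 m p.2 /\ perp F p.2) ->
  (forall v, D v -> perp F v -> lam * << v, v >> - penalty lam G v <= v *h* v) ->
  exists2 G', (forall p, List.In p G' -> l2 m p.2) &
    forall v, D v -> lam * << v, v >> - penalty lam G' v <= v *h* v.
Proof.
elim: F G => [|p F IH] G cpF hG hlb.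
  by exists G => [p /hG[]|v dv] //; exact: hlb.
have [cF hp p1 pp] := cpF; have [dp _ hpv] := hp; have lp := dl2 dp.
apply: (IH (p :: G)) => // [r [<-//|/hG[lr [_ pr]]//]|v dv pv].
have lv := dl2 dv; pose c := << v, p.2 >>; pose v' := v \+ (- c) ** p.2.
have dcp : D ((- c) ** p.2) by exact: domZ'.
have dv' : D v' by exact: domD'.
have lcp := dl2 dcp.
have pv' : perp (p :: F) v'.
  split; last by apply: perp_lin.
  by rewrite (iDl lv lcp lp) (iZl _ lp lp) p1 mulr1 subrr.
have := hlb v' dv' pv'.
have -> : penalty lam G v' = penalty lam G v.
  rewrite /penalty; elim: G hG {hlb} => [|r G IHG] hG; first by rewrite !big_nil.
  rewrite !big_cons IHG; last by move=> ? ?; apply: hG; right.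
  have [lr [rp _]] := hG r (or_introl erefl).
  by rewrite (iDl lv lcp lr) (iZl _ lp lr) (iC p.2) rp mulr0 addr0.
have pv2 : p.2 *h* v = p.1 * c by rewrite hpv// iZl// iC.
have pp2 : p.2 *h* p.2 = p.1 by rewrite hpv// iZl// p1 mulr1.
rewrite (innerDD m_gt0 lv lcp) (iZr _ lp lv) (iZr _ lp lcp) (iZl _ lp lp) p1 -/c.
rewrite (hDl dv dcp dv') (hDr dv dcp dv) (hDr dv dcp dcp) (hZr _ dp dv) (hZl _ dp dv).
rewrite (hZr _ dp dcp) (hZl _ dp dp) (hC dv dp) pv2 pp2.
rewrite /penalty big_cons -/(penalty lam G v) -/c; lra.
Qed.

(** A function vanishing on [A] only sees the tail of [g], whose squared norm is below [eta] for
    large [A]. *)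
Lemma inner_tail g (eta : R) : l2 m g -> 0 < eta -> exists A : {fset X}, forall f, l2 m f ->
  (forall x, x \in A -> f x = 0) -> << f, g >> ^+ 2 <= eta * << f, f >>.
Proof.
move=> lg e0; have /cvgrPdist_lt/(_ _ e0)[A _ hA] := l2_hsum m_gt0 lg lg.
have := hA A (fsubset_refl _) => /= {}hA; exists A => f lf fA.
pose gA x := if x \in A then g x else 0.
have cg : Cc gA by apply/CcP; exists A => x /negbTE h; rewrite /gA h.
have lgA := Cc_l2 m_gt0 cg; have lb := l2B' lg lgA.
have E1 : << f, g >> = << f, g \- gA >>.
  rewrite (iBr lg lgA lf) {3}/inner (@rsum_fin _ _ _ fset0) ?big_seq_fset0 ?subr0//.
  by move=> x _; rewrite /gA; case: ifP => [/fA->|_]; rewrite ?mulr0 !mul0r.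
have sumA : << g, gA >> = \sum_(x <- A) g x * g x * m x.
  rewrite /inner (@rsum_fin _ _ _ A).
    by apply: eq_big_seq => x xA; rewrite /gA xA.
  by move=> x /negbTE xA; rewrite /gA xA mulr0 mul0r.
have sumAA : << gA, gA >> = \sum_(x <- A) g x * g x * m x.
  rewrite /inner (@rsum_fin _ _ _ A).
    by apply: eq_big_seq => x xA; rewrite /gA xA.
  by move=> x /negbTE xA; rewrite /gA xA mulr0 mul0r.
rewrite E1; apply: le_trans (iCS lf lb) _; rewrite mulrC ler_wpM2r ?i0//.
rewrite (innerBB m_gt0 lg lgA) sumA sumAA; move: hA => /(le_lt_trans (ler_norm _)); lra.
Qed.

Lemma penalty_tail lam G (eta : R) : (forall p, List.In p G -> l2 m p.2) -> 0 < eta ->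
  exists A : {fset X}, forall f, l2 m f -> (forall x, x \in A -> f x = 0) ->
    penalty lam G f <= eta * << f, f >>.
Proof.
elim: G eta => [|p G IH] eta hG e0.
  exists fset0 => f lf _; rewrite /penalty big_nil mulr_ge0 ?i0// ltW//.
have e2 : 0 < eta / 2 by lra.
have [|A1 h1] := IH _ _ e2; first by move=> ? ?; apply: hG; right.
have n0 : 0 < `|lam - p.1| + 1 by rewrite ltr_wpDl.
have [A2 h2] := inner_tail (hG p (or_introl erefl)) (divr_gt0 e2 n0).
exists (A1 `|` A2)%fset => f lf f0.
have H1 : penalty lam G f <= eta / 2 * << f, f >>.
  by apply: h1 => // x xA; apply: f0; rewrite inE xA.
have H2 : << f, p.2 >> ^+ 2 <= eta / 2 / (`|lam - p.1| + 1) * << f, f >>.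
  by apply: h2 => // x xA; apply: f0; rewrite inE xA orbT.
rewrite /penalty big_cons -/(penalty lam G f).
have : (lam - p.1) * << f, p.2 >> ^+ 2 <= eta / 2 * << f, f >>.
  apply: (@le_trans _ _ ((`|lam - p.1| + 1) * << f, p.2 >> ^+ 2)).
    by rewrite ler_wpM2r ?sqr_ge0// ler_wpDr// ler_norm.
  rewrite mulrC -ler_pdivlMr// mulrAC; exact: H2.
lra.
Qed.

(* One half of Persson's theorem. *)
Lemma lower_bound_outside_finite lam : (lam%:E < lambda0_ess b m q)%E ->
  exists A : {fset X}, forall f, Cc f -> (forall x, x \in A -> f x = 0) ->
    lam * << f, f >> <= qform2 m b q f f.
Proof.
move=> hlam.
(* The chain is built for a slightly larger level; the margin [lam1 - lam] pays for the penalty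
   outside [A]. *)
have [lam1 ll1 hlam1] : exists2 lam1, lam < lam1 & (lam1%:E < lambda0_ess b m q)%E.
  case: (lambda0_ess b m q) hlam => [s| |]; last by [].
    by rewrite lte_fin => ls; exists ((lam + s) / 2); rewrite ?lte_fin; lra.
  by exists (lam + 1); [lra|rewrite ltry].
have [F cF hF] := finite_eigen_chain hlam1.
have [|v dv pv|G lG hG] := @chain_penalty lam1 F [::] cF; first by [].
  by rewrite /penalty big_nil subr0; exact: hF.
have d0 : 0 < lam1 - lam by lra.
have [A hA] := penalty_tail lam1 lG d0.
exists A => f cf fA; have lf := Cc_l2 m_gt0 cf.
have df : D f by exact: (Cc_dom m_gt0 b_graph b_lf hK cf).
rewrite -(cform2_Cc m_gt0 b_graph b_lf hK cf cf).
have := hG f df; have := hA f lf fA; lra.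
Qed.

End Spectral.

(** * Exponential weights *)

Lemma expR_trapezoid (R : realType) (z : R) : 0 <= z -> 2 * (expR z - 1) <= z * (expR z + 1).
Proof.
rewrite le_eqVlt => /predU1P[<-|z0]; first by rewrite expR0; lra.
(* [f z - f 0] is the right side minus the left side of the claim, and [df] is nonnegative by
   [expR_ge1Dx] at [- c]. *)
pose f (x : R) := (x - 2) * expR x + x.
pose df (x : R) := (x - 1) * expR x + 1.
have fd (x : R) : is_derive x 1 f (df x).
  apply: is_derive_eq; rewrite /df /GRing.scale /=; ring.
have [c] := MVT z0 (fun x _ => fd x) (derivable_within_continuous (fun x _ => @ex_derive _ _ _ _ _ _ _ (fd x))).
rewrite in_itv /= => /andP[c0 cz]; rewrite subr0 /f expR0 => h.
have : 0 <= df c.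
  rewrite /df; have := expR_ge1Dx (- c); have := expR_gt0 c => e0.
  rewrite -(ler_pM2r e0) expRN mulVf ?gt_eqF//; lra.
nra.
Qed.

(** The trapezoidal bound multiplied by [expR q], squared, and followed by
    [(P + Q) ^ 2 <= 2 * (P ^ 2 + Q ^ 2)]. *)
Lemma expR_sub_sqr (R : realType) (p q : R) :
  (expR p - expR q) ^+ 2 <= (p - q) ^+ 2 * ((expR p ^+ 2 + expR q ^+ 2) / 2).
Proof.
wlog pq : p q / q <= p.
  move=> h; have [/h//|/ltW/h] := leP q p.
  by rewrite -sqrrN opprB -[(q - p) ^+ 2]sqrrN opprB addrC [_ + expR p ^+ 2]addrC.
have z0 : 0 <= p - q by rewrite subr_ge0.
have := expR_trapezoid z0; rewrite expRB; have := expR_gt0 q; have := expR_gt0 p.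
set P := expR p; set Q := expR q => P0 Q0.
have Pq : P / Q * Q = P by rewrite mulfVK// gt_eqF.
move=> h; have {}h : 2 * (P - Q) <= (p - q) * (P + Q).
  have := ler_wpM2r (ltW Q0) h; rewrite -!mulrA !mulrDl Pq; lra.
have d0 : 0 <= P - Q by rewrite subr_ge0 ler_expR.
have h2 : (2 * (P - Q)) ^+ 2 <= ((p - q) * (P + Q)) ^+ 2.
  by rewrite ler_pXn2r// nnegrE ?mulr_ge0// ?addr_ge0 ?ltW.
have h3 : (P + Q) ^+ 2 <= 2 * (P ^+ 2 + Q ^+ 2) by have := sqr_ge0 (P - Q); nra.
have h4 : ((p - q) * (P + Q)) ^+ 2 <= (p - q) ^+ 2 * (2 * (P ^+ 2 + Q ^+ 2)).
  by rewrite exprMn ler_wpM2l// sqr_ge0.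
move: h2 h4; rewrite (exprMn 2); lra.
Qed.

(** Crude estimates suffice: [2 * a <= 1 + a <= expR a] gives [r <= 1], hence [expR r <= 4] and
    [r ^+ 2 <= r <= 2 * a], so the product is at most [5 / 8 * a]. *)
Lemma rate_bound (R : realType) (a : R) : 0 < a -> a <= 1 ->
  let r := 2 * a * expR (- a) in 0 < r /\ r ^+ 2 * ((1 + expR r) / 16) < a.
Proof.
move=> a0 a1 r; have e0 := expR_gt0 (- a).
have r0 : 0 < r by rewrite /r !mulr_gt0.
have ae : 2 * (a * expR (- a)) <= 1.
  have : 2 * a <= expR a by have := expR_ge1Dx a; lra.
  by rewrite -(ler_pM2r e0) -expRD subrr expR0 mulrA.
have r1 : r <= 1 by rewrite /r -mulrA.
have er : expR r <= 4.
  have h : expR (r / 2) <= 2.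
    have : 2^-1 <= expR (- (r / 2)) by have := expR_ge1Dx (- (r / 2)); lra.
    by rewrite expRN lef_pV2 ?posrE// expR_gt0.
  have -> : r = r / 2 + r / 2 by lra.
  by rewrite expRD; have := expR_gt0 (r / 2); nra.
split => //.
have r2 : r ^+ 2 <= 2 * a.
  have e1 : expR (- a) <= 1 by rewrite -[leRHS]expR0 ler_expR; lra.
  by have : r ^+ 2 <= r; [rewrite expr2 ler_piMl// ltW|move=> h; apply: le_trans h _; rewrite /r; nra].
have : (1 + expR r) / 16 < 1 / 2 by lra.
have : 0 < r ^+ 2 by rewrite exprn_gt0.
nra.
Qed.

Section Weight.
Context {R : realType} {X : choiceType} (m : X -> R) (b : X -> X -> R) (d : X -> X -> R).
Hypothesis m_gt0 : forall x, 0 < m x.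
Hypothesis b_graph : is_graph b.
Hypothesis b_lf : locally_finite b.
Hypothesis d_intrinsic : intrinsic_metric b m d.
Hypothesis d_jump : forall x y, 0 < b x y -> d x y <= 1.
Variables (o : X) (r : R) (A : {fset X}).
Hypothesis r_gt0 : 0 < r.

(** The 16 collects a factor 2 from the definition of the gradient, 4 from the exponent [r / 2], and
    2 from the mean in [expR_sub_sqr]. The term [expR r] bounds the ratio of the squared weights at
    the ends of an edge. *)
Definition rate : R := r ^+ 2 * ((1 + expR r) / 16).

(** The exponent is halved because the weight enters squared. Truncation makes it bounded, and the
    zeros on [A] make its multiples admissible for the lower bound of the form. *)
Definition wt (N : R) (x : X) : R :=
  if x \in A then 0 else expR (r * Num.min (d o x) N / 2).

(* Bounds the gradient of [wt N] at and next to [A], uniformly in [N]. *)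
Definition wt_bd (x : X) : R :=
  if x \in hull b A then
    \sum_(y <- nbr b x) b x y * (expR (r * d o x) + expR (r * d o y))
  else 0.

Lemma wt_ge0 N x : 0 <= wt N x.
Proof. by rewrite /wt; case: ifP => _; [exact: lexx|exact: expR_ge0]. Qed.

Lemma wt_le N x : wt N x <= expR (r * N / 2).
Proof.
rewrite /wt; case: ifP => _; first exact: expR_ge0.
by rewrite ler_expR ler_pM2r// ler_pM2l// ge_min lexx orbT.
Qed.

Lemma wt_sqr_le N x : wt N x ^+ 2 <= expR (r * d o x).
Proof.
rewrite /wt; case: ifP => _; first by rewrite expr0n expR_ge0.
by rewrite expr2 -expRD -splitr ler_expR ler_pM2l// ge_min lexx.
Qed.

Lemma wt_bd_ge0 x : 0 <= wt_bd x.
Proof.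
rewrite /wt_bd; case: ifP => _; last exact: lexx.
apply: sumr_ge0 => y _.
by apply: mulr_ge0; [exact: b_ge0|rewrite addr_ge0// expR_ge0].
Qed.

Lemma min_lip N x y : (Num.min (d o x) N - Num.min (d o y) N) ^+ 2 <= d x y ^+ 2.
Proof.
have [d0 _ dsym dtri _] := d_intrinsic.
have h1 := dtri o x y; have h2 := dtri o y x; rewrite (dsym y x) in h2.
rewrite -(real_normK (num_real (_ - _))) ler_pXn2r ?nnegrE// ?d0//.
rewrite ler_norml; have := d0 x y.
rewrite !minEle; case: ifP; case: ifP; lra.
Qed.

Lemma intrinsic_sum x B : \sum_(y <- (B : {fset X})) b x y * d x y ^+ 2 <= m x.
Proof.
have [_ _ _ _ h] := d_intrinsic.
rewrite -lee_fin; apply: le_trans (h x); apply: sum_le_esum => y.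
by rewrite mulr_ge0 ?sqr_ge0 ?b_ge0.
Qed.

(** Off the hull of [A] every neighbour of [x] avoids [A], so both ends of each edge carry
    exponentials. On the hull the drop to 0 destroys this comparison, and [wt_bd] takes over. *)
Lemma wt_grad N x B :
  \sum_(y <- (B : {fset X})) b x y * (wt N x - wt N y) ^+ 2
  <= 2 * rate * (wt N x ^+ 2 * m x) + wt_bd x.
Proof.
have rt0 : 0 <= rate.
  by rewrite /rate mulr_ge0 ?sqr_ge0// divr_ge0// addr_ge0// expR_ge0.
have w20 y : 0 <= wt N y ^+ 2 by exact: sqr_ge0.
have [xh|xh] := boolP (x \in hull b A).
  rewrite /wt_bd xh; apply: (@le_trans _ _
    (\sum_(y <- nbr b x) b x y * (expR (r * d o x) + expR (r * d o y)))); last first.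
    by rewrite lerDr; apply: mulr_ge0; apply: mulr_ge0 => //; exact: ltW.
  set F := fun y => b x y * (expR (r * d o x) + expR (r * d o y)).
  have F0 y : 0 <= F y.
    by apply: mulr_ge0; [exact: b_ge0|rewrite addr_ge0// expR_ge0].
  apply: (@le_trans _ _ (\sum_(y <- B) F y)).
    apply: ler_sum => y _; rewrite /F ler_wpM2l ?b_ge0//.
    apply: le_trans (lerD (wt_sqr_le N x) (wt_sqr_le N y)).
    by have := wt_ge0 N x; have := wt_ge0 N y; nra.
  rewrite -(@big_fset_supp _ _ F (nbr b x) (nbr b x `|` B)%fset).
  - exact: le_sum_fset F0 (fsubsetUr _ _).
  - exact: fsubsetUl.
  - by move=> y yx; rewrite /F (notin_nbr b_graph b_lf) ?mul0r.
rewrite /wt_bd (negbTE xh) addr0.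
have xA : x \notin A by apply: contra xh; apply/fsubsetP; exact: sub_hull.
apply: (@le_trans _ _ (\sum_(y <- B) (2 * rate * wt N x ^+ 2) * (b x y * d x y ^+ 2))); last first.
  rewrite -mulr_sumr [leRHS]mulrA; apply: ler_wpM2l; last exact: intrinsic_sum.
  by apply: mulr_ge0 => //; apply: mulr_ge0.
apply: ler_sum => y _; rewrite [leRHS]mulrCA.
have := b_ge0 b_graph x y; rewrite le_eqVlt => /predU1P[<-|bxy]; first by rewrite !mul0r.
rewrite ler_pM2l//.
have yA : y \notin A.
  apply/negP => yA; move: bxy; rewrite (b_sym b_graph) (hull_b0 b_graph b_lf yA xh).
  by rewrite ltxx.
rewrite /wt (negbTE xA) (negbTE yA).
apply: le_trans (expR_sub_sqr _ _) _.
set s := Num.min (d o x) N; set t := Num.min (d o y) N.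
have st : (s - t) ^+ 2 <= d x y ^+ 2 by exact: min_lip.
(* The jump size enters here, to bound the weight at [y] by the weight at [x]. *)
have ts : t - s <= 1.
  have d1 := d_jump bxy; have [d0 _ _ _ _] := d_intrinsic.
  have : d x y ^+ 2 <= 1 by have := d0 x y; nra.
  move=> h; have : (t - s) ^+ 2 <= 1 by nra.
  nra.
have sq z : expR (r * z / 2) ^+ 2 = expR (r * z) by rewrite expr2 -expRD -splitr.
rewrite !sq.
have et : expR (r * t) <= expR r * expR (r * s).
  by rewrite -expRD ler_expR; have := ler_wpM2l (ltW r_gt0) ts; rewrite mulr1 mulrBr; lra.
rewrite (_ : r * s / 2 - r * t / 2 = (r / 2) * (s - t)); last by field.
rewrite exprMn /rate.
have es := expR_gt0 (r * s); have er := expR_gt0 r.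
rewrite [leRHS](_ : _ = (r / 2) ^+ 2 * d x y ^+ 2 * ((expR (r * s) + expR r * expR (r * s)) / 2)); last by field.
apply: ler_pM.
- by rewrite mulr_ge0// sqr_ge0.
- by rewrite divr_ge0// addr_ge0// expR_ge0.
- by rewrite ler_wpM2l// sqr_ge0.
- by rewrite ler_pM2r// lerD2l.
Qed.

End Weight.

(** * Agmon estimates *)

Section Agmon.
Context {R : realType} {X : choiceType} (m : X -> R) (b : X -> X -> R) (q : X -> R).
Hypothesis m_gt0 : forall x, 0 < m x.
Hypothesis b_graph : is_graph b.
Hypothesis b_lf : locally_finite b.
Variables (u : X -> R) (lam lam1 rho M : R) (A A' : {fset X}) (w c : X -> R).
Hypothesis lower : forall f, Cc f -> (forall x, x \in A -> f x = 0) ->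
  lam1 * inner m f f <= qform2 m b q f f.
Hypothesis w_A : forall x, x \in A -> w x = 0.
Hypothesis w_ge0 : forall x, 0 <= w x.
Hypothesis w_le : forall x, w x <= M.
Hypothesis c_ge0 : forall x, 0 <= c x.
Hypothesis c_A' : forall x, x \notin A' -> c x = 0.
Hypothesis w_grad : forall x (B : {fset X}),
  \sum_(y <- B) b x y * (w x - w y) ^+ 2 <= 2 * rho * (w x ^+ 2 * m x) + c x.
Hypothesis rho_ge0 : 0 <= rho.
Hypothesis gap : rho < lam1 - lam.

Local Notation hp := (qform2 m b (pospart q)).
Local Notation qform2 := (qform2 m b q).
Local Notation "<< f , g >>" := (inner m f g).

(** The lower bound at [u * g] is combined with the ground state transform and with the equation
    tested against [u * g ^ 2]. For a subsolution [u >= 0] makes this test function nonnegative; a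
    solution gives equality whatever its sign. *)
Lemma subsolution_energy g : solution b m q lam u \/ positive_subsolution b m q lam u ->
  Cc g -> (forall x, x \in A -> g x = 0) -> \forall B \near tot X,
  (lam1 - lam) * \sum_(x <- (B : {fset X})) u x ^+ 2 * g x ^+ 2 * m x <=
  2^-1 * \sum_(x <- B) u x ^+ 2 * \sum_(y <- B) b x y * (g x - g y) ^+ 2.
Proof.
move=> hu cg gA; have cug : Cc (fun x => u x * g x) by exact: Cc_mul.
have cug2 : Cc (fun x => u x * g x ^+ 2).
  have : Cc (fun x => u x * g x * g x) by exact: Cc_mul.
  by congr Cc; apply/funext => x; rewrite expr2 mulrA.
near=> B.
have := lower cug _; rewrite (near (qform2_near m_gt0 b_graph b_lf q cug cug) B)//.
rewrite (near (inner_near m (fun x => u x * g x) cug) B)//.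
rewrite bil_ground (near (green_near m_gt0 b_graph b_lf q u cug2) B)//.
move=> h; have {}h := h (fun x xA => etrans (congr1 (fun z => u x * z) (gA x xA)) (mulr0 _)).
have E : \sum_(x <- B) u x * g x * (u x * g x) * m x =
    \sum_(x <- B) u x ^+ 2 * g x ^+ 2 * m x by apply: eq_bigr => x _; ring.
rewrite E in h.
have h1 : \sum_(x <- B) u x * g x ^+ 2 * (m x * formalH b m q u x) <=
    lam * \sum_(x <- B) u x ^+ 2 * g x ^+ 2 * m x.
  rewrite mulr_sumr; apply: ler_sum => x _.
  have g0 : 0 <= g x ^+ 2 * m x by rewrite mulr_ge0 ?sqr_ge0// ltW.
  rewrite [leRHS](_ : _ = g x ^+ 2 * m x * (u x * (lam * u x))); last by ring.
  rewrite [leLHS](_ : _ = g x ^+ 2 * m x * (u x * formalH b m q u x)); last by ring.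
  apply: ler_wpM2l => //; case: hu => [[_ hs]|[_ u0 hs]].
    by have /eqP := hs x; rewrite subr_eq0 => /eqP ->.
  by apply: ler_wpM2l => //; have := hs x; lra.
have := ground_rem_le b_graph B u g; lra.
Unshelve. all: by end_near. Qed.

(** The test function is [phi n * w]. Young's inequality splits its gradient so that the part with
    the gradient of [w] keeps a constant close to [rho], while the part with the gradient of [phi n]
    is bounded by a multiple of [en n], which tends to 0. *)
Lemma approximable_weighted : approximable b m u ->
  solution b m q lam u \/ positive_subsolution b m q lam u ->
  forall S : {fset X}, (lam1 - lam - rho) * \sum_(x <- S) u x ^+ 2 * w x ^+ 2 * m x <=
    2 * \sum_(x <- A') u x ^+ 2 * c x.
Proof.
move=> [_ [phi [cphi mphi lphi ephi]]] hu S.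
pose kappa := lam1 - lam - rho; have k0 : 0 < kappa by rewrite subr_gt0.
have w2M x : w x ^+ 2 <= M ^+ 2.
  by rewrite ler_pXn2r ?nnegrE//; exact: le_trans (w_ge0 x) (w_le x).
have phi0 n x : 0 <= phi n x by have [] := mphi n x.
have phi1 n x : phi n x <= 1.
  have mono : {homo (fun n => phi n x) : n k / (n <= k)%N >-> n <= k}.
    by apply/nondecreasing_seqP => k; have [] := mphi k x.
  have := lphi x; move=> /[dup] /cvg_lim <- //cv.
  by apply: (nondecreasing_cvgn_le mono); apply/cvg_ex; exists 1.
pose En n : \bar R := \esum_(x in [set: X]) ((u x ^+ 2)%:E * gradsq b m (phi n) x * (m x)%:E)%E.
pose en n : R := fine (En n).
have [Enfin en0] := (fine_cvgP _ _).1 ephi.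
(* With this [eps] the surplus [eps * rho] uses at most half of the gap, and [eps <= 1] keeps the
   term with [c] below [C1] after the prefactor 1/2. The shift [rho + 1] allows [rho = 0]. *)
pose eps := Num.min 1 (kappa / (2 * (rho + 1))).
have r1 : 0 < rho + 1 by rewrite ltr_wpDl.
have eps0 : 0 < eps by rewrite /eps lt_min ltr01 divr_gt0// mulr_gt0.
have eps1 : eps <= 1 by rewrite /eps ge_min lexx.
have epsr : eps * rho <= kappa / 2.
  have : eps <= kappa / (2 * (rho + 1)) by rewrite /eps ge_min lexx orbT.
  by rewrite ler_pdivlMr ?mulr_gt0// mulrCA mulrDr mulr1; lra.
pose C1 := \sum_(x <- A') u x ^+ 2 * c x.
have C10 : 0 <= C1 by apply: sumr_ge0 => x _; rewrite mulr_ge0// sqr_ge0.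
have key : \forall n \near \oo,
    kappa / 2 * \sum_(x <- S) u x ^+ 2 * (phi n x * w x) ^+ 2 * m x <=
    C1 + (1 + eps^-1) * M ^+ 2 * en n.
  near=> n.
  have Efin : En n \is a fin_num by near: n.
  pose g x := phi n x * w x.
  have cg : Cc g.
    have : Cc (fun x => w x * phi n x) by exact: Cc_mul.
    by congr Cc; apply/funext => x; rewrite mulrC.
  have gA x : x \in A -> g x = 0 by move=> /w_A h; rewrite /g h mulr0.
  have [A0 hA0] := (CcP (phi n)).1 (cphi n).
  near (tot X) => B.
  have hB : (lam1 - lam) * \sum_(x <- B) u x ^+ 2 * g x ^+ 2 * m x <=
    2^-1 * \sum_(x <- B) u x ^+ 2 * \sum_(y <- B) b x y * (g x - g y) ^+ 2.
    by near: B; exact: (subsolution_energy hu cg gA).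
  have AB : (hull b A0 `<=` B)%fset by near: B; exact: near_totally.
  have SB : (S `<=` B)%fset by near: B; exact: near_totally.
  have A'B : (A' `<=` B)%fset by near: B; exact: near_totally.
  have grad : \sum_(x <- B) u x ^+ 2 * \sum_(y <- B) b x y * (phi n x - phi n y) ^+ 2
      <= 2 * en n.
    have G0 x : 0 <= u x ^+ 2 * \sum_(y <- B) b x y * (phi n x - phi n y) ^+ 2.
      by rewrite mulr_ge0 ?sqr_ge0// sumr_ge0// => y _; rewrite mulr_ge0 ?sqr_ge0 ?b_ge0.
    rewrite -ler_pdivrMl// mulr_sumr -lee_fin /en fineK//.
    apply: le_trans (sum_le_esum B _) _; first by move=> x; rewrite mulr_ge0.
    apply: le_esum => x _.
    rewrite (gradsq_fin m b_graph b_lf x hA0 AB) -!EFinM lee_fin le_eqVlt; apply/orP; left.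
    by apply/eqP; field; rewrite gt_eqF.
  have pt x y : (g x - g y) ^+ 2 <= (1 + eps) * (phi n x ^+ 2 * (w x - w y) ^+ 2)
      + (1 + eps^-1) * M ^+ 2 * (phi n x - phi n y) ^+ 2.
    set s := phi n x * (w x - w y); set t := w y * (phi n x - phi n y).
    have -> : g x - g y = s + t by rewrite /g /s /t; ring.
    have h : (s + t) ^+ 2 <= (1 + eps) * s ^+ 2 + (1 + eps^-1) * t ^+ 2.
      have : 0 <= eps^-1 * (eps * s - t) ^+ 2 by rewrite mulr_ge0 ?sqr_ge0// invr_ge0 ltW.
      have -> : eps^-1 * (eps * s - t) ^+ 2 = eps * s ^+ 2 - 2 * s * t + eps^-1 * t ^+ 2.
        by field; rewrite gt_eqF.
      by move=> h; rewrite sqrrD mulr2n; lra.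
    apply: le_trans h _; rewrite /s exprMn lerD2l -mulrA ler_wpM2l//.
      by rewrite addr_ge0// invr_ge0 ltW.
    by rewrite /t exprMn ler_wpM2r// sqr_ge0.
  have est : 2^-1 * \sum_(x <- B) u x ^+ 2 * \sum_(y <- B) b x y * (g x - g y) ^+ 2 <=
      (1 + eps) * rho * \sum_(x <- B) u x ^+ 2 * g x ^+ 2 * m x + C1
      + (1 + eps^-1) * M ^+ 2 * en n.
    pose T1 x := u x ^+ 2 * (2 * rho * (g x ^+ 2 * m x) + c x).
    pose T2 x := u x ^+ 2 * \sum_(y <- B) b x y * (phi n x - phi n y) ^+ 2.
    apply: (@le_trans _ _ (2^-1 * \sum_(x <- B)
        ((1 + eps) * T1 x + (1 + eps^-1) * M ^+ 2 * T2 x))).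
      rewrite ler_pM2l ?invr_gt0//; apply: ler_sum => x _.
      rewrite /T1 /T2 [X in _ <= X](_ : _ = u x ^+ 2 *
        ((1 + eps) * (2 * rho * (g x ^+ 2 * m x) + c x) + (1 + eps^-1) * M ^+ 2 *
          \sum_(y <- B) b x y * (phi n x - phi n y) ^+ 2)); last by ring.
      apply: ler_wpM2l; first exact: sqr_ge0.
      apply: (@le_trans _ _ (\sum_(y <- B) ((1 + eps) * phi n x ^+ 2 * (b x y * (w x - w y) ^+ 2)
         + (1 + eps^-1) * M ^+ 2 * (b x y * (phi n x - phi n y) ^+ 2)))).
        apply: ler_sum => y _; have := ler_wpM2l (b_ge0 b_graph x y) (pt x y).
        by move/le_trans; apply; rewrite le_eqVlt; apply/orP; left; apply/eqP; ring.
      rewrite big_split /= -!mulr_sumr lerD2r -[leLHS]mulrA.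
      apply: ler_wpM2l; first by rewrite addr_ge0// ltW.
      have p2 : 0 <= phi n x ^+ 2 by exact: sqr_ge0.
      apply: le_trans (ler_wpM2l p2 (w_grad x B)) _.
      have : phi n x ^+ 2 <= 1 by have := phi0 n x; have := phi1 n x; nra.
      by move=> p1; have := c_ge0 x => cx; rewrite /g exprMn; nra.
    rewrite big_split /= -!mulr_sumr.
    have -> : \sum_(x <- B) T1 x =
        2 * rho * \sum_(x <- B) u x ^+ 2 * g x ^+ 2 * m x + C1.
      rewrite /C1 -(@big_fset_supp _ _ _ A' B) => [|//|x /c_A' ->]; last by rewrite mulr0.
      by rewrite mulr_sumr -big_split; apply: eq_bigr => x _ /=; rewrite /T1; ring.
    have M2 : 0 <= (1 + eps^-1) * M ^+ 2.
      by rewrite mulr_ge0 ?sqr_ge0// addr_ge0// invr_ge0 ltW.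
    have := ler_wpM2l M2 grad; rewrite -/(\sum_(x <- B) T2 x); nra.
  have F0 x : 0 <= u x ^+ 2 * g x ^+ 2 * m x.
    by apply: mulr_ge0; [apply: mulr_ge0; exact: sqr_ge0|exact: ltW].
  have sumS := le_sum_fset F0 SB.
  have s0 : 0 <= \sum_(x <- B) u x ^+ 2 * g x ^+ 2 * m x by apply: sumr_ge0 => x _.
  have h3 := le_trans hB est; have h4 := ler_wpM2r s0 epsr.
  apply: le_trans (ler_wpM2l (ltW _) sumS) _; first by rewrite divr_gt0.
  by move: h3 h4; rewrite /kappa; lra.
have lim1 : kappa / 2 * \sum_(x <- S) u x ^+ 2 * (phi n x * w x) ^+ 2 * m x @[n --> \oo] -->
    kappa / 2 * \sum_(x <- S) u x ^+ 2 * (1 * w x) ^+ 2 * m x.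
  apply: cvgMl_tmp; apply: cvg_sumr => x; apply: cvgMr_tmp; apply: cvgMl_tmp.
  rewrite expr2; under eq_cvg do rewrite expr2.
  by apply: cvgM; apply: cvgMr_tmp; exact: lphi.
have lim2 : C1 + (1 + eps^-1) * M ^+ 2 * en n @[n --> \oo] --> C1 + (1 + eps^-1) * M ^+ 2 * 0.
  by apply: cvgD; [exact: cvg_cst|exact: cvgMl_tmp].
have := ler_cvg_to lim1 lim2 key; rewrite mulr0 addr0.
under eq_bigr do rewrite mul1r.
by rewrite -/kappa -/C1 => /(_ _); lra.
Unshelve. all: by end_near. Qed.

(** * Solutions in the form domain *)

Variable K : R.
Hypothesis hK : forall f, Cc f -> << f, f >> <= qform2 f f + K * << f, f >>.

Let cl := @Cc_l2 _ _ _ m_gt0.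

Lemma pospart_ge0 x : 0 <= pospart q x. Proof. by rewrite le_max lexx orbT. Qed.

Lemma qform2_le_pos f : Cc f -> qform2 f f <= hp f f.
Proof.
move=> cf; near (tot X) => B.
rewrite (near (qform2_near m_gt0 b_graph b_lf q cf cf) B)//.
rewrite (near (qform2_near m_gt0 b_graph b_lf (pospart q) cf cf) B)//.
rewrite /bil lerD2l; apply: ler_sum => x _; rewrite -!mulrA; apply: ler_wpM2r.
  by rewrite mulrA -expr2 mulr_ge0 ?sqr_ge0// ltW.
by rewrite /pospart le_max lexx.
Unshelve. all: by end_near. Qed.

(** The negative part contributes the difference of the forms of [pospart q] and [q], so [classV]
    rearranges to [eps * hp f f <= qform2 f f + C * << f, f >>]. It is this form of nonnegative
    terms, unlike the one with [q], that can be compared termwise after multiplication by a bounded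
    weight. *)
Lemma hp_bound : classV b m q -> exists C : R, 0 < C /\ forall f, Cc f ->
  hp f f <= C * sform m b q K f f.
Proof.
move=> [eps [C [e0 C0 h]]]; exists (eps^-1 * (1 + (C + `|K|))).
have i0 : 0 < eps^-1 by rewrite invr_gt0.
split; first by rewrite mulr_gt0// addr_gt0// ltr_wpDr.
move=> f cf; have := h f cf.
rewrite (inner_rsum m f) qform_hb//.
have -> : rsum (fun x => negpart q x * f x ^+ 2 * m x) = hp f f - qform2 f f.
  near (tot X) => B.
  rewrite (near (qform2_near m_gt0 b_graph b_lf q cf cf) B)//.
  rewrite (near (qform2_near m_gt0 b_graph b_lf (pospart q) cf cf) B)//.
  rewrite (@rsum_fin _ _ _ B); last first.
    have : forall x, x \notin B -> f x = 0 by near: B; exact: Cc_near.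
    by move=> hB x /hB ->; rewrite expr0n mulr0 mul0r.
  rewrite /bil opprD addrACA subrr add0r -sumrB; apply: eq_bigr => x _.
  rewrite /negpart /pospart !maxEle; case: ifP; case: ifP => h1 h2; try ring.
    have : q x = 0 by lra.
    by move=> ->; ring.
  by exfalso; move: h1 h2 => /negbT + /negbT; rewrite -!ltNge; lra.
move=> h1; have f0 := inner_ge0 m_gt0 (cl cf).
have h2 : eps * hp f f <= qform2 f f + C * << f, f >> by lra.
have h3 := sform_inner hK cf.
rewrite -mulrA -ler_pdivrMl ?invr_gt0// invrK; apply: le_trans h2 _.
have k1 : - K <= `|K| by rewrite -normrN ler_norm.
have h4 : (C + `|K|) * << f, f >> <= (C + `|K|) * sform m b q K f f.
  by apply: ler_wpM2l => //; rewrite addr_ge0// ltW.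
have h5 := ler_wpM2r f0 k1.
rewrite [leRHS]mulrDl mul1r; move: h4 h5; rewrite {2}/sform; lra.
Unshelve. all: by end_near. Qed.

(** By the Leibniz rule, [w y ^ 2 * (f x - f y)] costs [M ^ 4] times the energy, and
    [f x * (w x ^ 2 - w y ^ 2)] is controlled by the norm, since [c] has finite support and so is at
    most a multiple of [m]. The constant depends on [M], but it serves only to pass to a limit. *)
Lemma weight_mul_bound : classV b m q -> exists C : R, 0 < C /\ forall f, Cc f ->
  sform m b q K (fun x => w x ^+ 2 * f x) (fun x => w x ^+ 2 * f x) <= C * sform m b q K f f.
Proof.
move=> /hp_bound[C [C0 hC]].
pose C2 := \sum_(x <- A') c x / m x.
have C20 : 0 <= C2 by apply: sumr_ge0 => x _; rewrite divr_ge0// ltW.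
have cC2 x : c x <= C2 * m x.
  have [xA|/c_A' ->] := boolP (x \in A'); last by rewrite mulr_ge0// ltW.
  rewrite -ler_pdivrMr// /C2 (big_fsetD1 x)//= lerDl sumr_ge0// => y _.
  by rewrite divr_ge0// ltW.
have w2M x : w x ^+ 2 <= M ^+ 2.
  by rewrite ler_pXn2r ?nnegrE//; exact: le_trans (w_ge0 x) (w_le x).
have w4M x : (w x ^+ 2) ^+ 2 <= M ^+ 4.
  by rewrite -[4%N]/(2 * 2)%N exprM ler_pXn2r ?nnegrE ?sqr_ge0.
have M4 : 0 <= M ^+ 4 by rewrite -[4%N]/(2 * 2)%N exprM sqr_ge0.
pose C3 := 4 * M ^+ 2 * (2 * rho * M ^+ 2 + C2).
have C30 : 0 <= C3.
  have M2 : 0 <= M ^+ 2 by exact: sqr_ge0.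
  by rewrite /C3 mulr_ge0 ?addr_ge0 ?(mulr_ge0 _ M2)// ?mulr_ge0.
have grad2 x (B : {fset X}) :
    \sum_(y <- B) b x y * (w x ^+ 2 - w y ^+ 2) ^+ 2 <= C3 * m x.
  apply: (@le_trans _ _ (4 * M ^+ 2 * \sum_(y <- B) b x y * (w x - w y) ^+ 2)).
    rewrite mulr_sumr; apply: ler_sum => y _; rewrite [leRHS]mulrCA ler_wpM2l ?b_ge0//.
    rewrite subr_sqr exprMn [leRHS]mulrC ler_wpM2l ?sqr_ge0//.
    have := w2M x; have := w2M y; have := sqr_ge0 (w x - w y); lra.
  rewrite /C3 -[leRHS]mulrA; apply: ler_wpM2l.
    by apply: mulr_ge0 => //; exact: sqr_ge0.
  apply: le_trans (w_grad x B) _; rewrite [leRHS]mulrDl; apply: lerD => //.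
  rewrite -[leRHS]mulrA; apply: ler_wpM2l; first exact: mulr_ge0.
  by apply: ler_wpM2r => //; exact: ltW.
pose C4 := (2 * M ^+ 4 + C3) * (C + 1) + `|K| * M ^+ 4 + 1; exists C4.
have Cp : 0 <= C + 1 by apply: addr_ge0 => //; exact: ltW.
split.
  rewrite /C4 ltr_wpDl//; apply: addr_ge0; last exact: mulr_ge0.
  by apply: mulr_ge0 => //; apply: addr_ge0 => //; exact: mulr_ge0.
move=> f cf; have cwf : Cc (fun x => w x ^+ 2 * f x) by exact: Cc_mul.
have e1 := sform_inner hK cf.
have f0 := inner_ge0 m_gt0 (cl cf).
have inn : << fun x => w x ^+ 2 * f x, fun x => w x ^+ 2 * f x >> <= M ^+ 4 * << f, f >>.
  near (tot X) => B.
  rewrite (near (inner_near m f cf) B)// (near (inner_near m _ cwf) B)// mulr_sumr.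
  apply: ler_sum => x _; have h0 : 0 <= f x * f x * m x.
    by rewrite -expr2 mulr_ge0 ?sqr_ge0// ltW.
  apply: le_trans (ler_wpM2r h0 (w4M x)); rewrite le_eqVlt; apply/orP; left; apply/eqP; ring.
have inn0 := inner_ge0 m_gt0 (cl cwf).
have pos : hp (fun x => w x ^+ 2 * f x) (fun x => w x ^+ 2 * f x) <=
    2 * M ^+ 4 * hp f f + C3 * << f, f >>.
  near (tot X) => B.
  rewrite (near (qform2_near m_gt0 b_graph b_lf (pospart q) cf cf) B)//.
  rewrite (near (qform2_near m_gt0 b_graph b_lf (pospart q) cwf cwf) B)//.
  rewrite (near (inner_near m f cf) B)// /bil.
  pose S1 := \sum_(x <- B) \sum_(y <- B) b x y * (f x - f y) * (f x - f y).
  pose S2 := \sum_(x <- B) pospart q x * f x * f x * m x.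
  pose S3 := \sum_(x <- B) f x * f x * m x.
  rewrite -/S1 -/S2 -/S3.
  have h1 : \sum_(x <- B) \sum_(y <- B) b x y * (w x ^+ 2 * f x - w y ^+ 2 * f y) *
      (w x ^+ 2 * f x - w y ^+ 2 * f y) <= 2 * M ^+ 4 * S1 + 2 * (C3 * S3).
    apply: (@le_trans _ _ (\sum_(x <- B) (2 * M ^+ 4 *
       (\sum_(y <- B) b x y * (f x - f y) * (f x - f y))
       + 2 * (f x ^+ 2 * \sum_(y <- B) b x y * (w x ^+ 2 - w y ^+ 2) ^+ 2)))).
      apply: ler_sum => x _; rewrite !mulr_sumr -big_split /=; apply: ler_sum => y _.
      set p := w y ^+ 2 * (f x - f y); set s := f x * (w x ^+ 2 - w y ^+ 2).
      have -> : w x ^+ 2 * f x - w y ^+ 2 * f y = p + s by rewrite /p /s; ring.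
      have h : (p + s) ^+ 2 <= 2 * M ^+ 4 * (f x - f y) ^+ 2 + 2 * s ^+ 2.
        have : p ^+ 2 <= M ^+ 4 * (f x - f y) ^+ 2.
          by rewrite /p exprMn ler_wpM2r// sqr_ge0.
        have := sqr_ge0 (p - s); lra.
      rewrite -[leLHS]mulrA -expr2; apply: le_trans (ler_wpM2l (b_ge0 b_graph x y) h) _.
      by rewrite le_eqVlt; apply/orP; left; apply/eqP; rewrite /s; ring.
    rewrite big_split /= -mulr_sumr -/S1 lerD2l -mulr_sumr ler_pM2l// mulr_sumr.
    apply: ler_sum => x _; have := ler_wpM2l (sqr_ge0 (f x)) (grad2 x B).
    by move/le_trans; apply; rewrite le_eqVlt; apply/orP; left; apply/eqP; ring.
  have h2 : \sum_(x <- B) pospart q x * (w x ^+ 2 * f x) * (w x ^+ 2 * f x) * m x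
      <= M ^+ 4 * S2.
    rewrite mulr_sumr; apply: ler_sum => x _.
    have h0 : 0 <= pospart q x * f x * f x * m x.
      rewrite -!mulrA; apply: mulr_ge0; first exact: pospart_ge0.
      by rewrite mulrA -expr2 mulr_ge0 ?sqr_ge0// ltW.
    apply: le_trans (ler_wpM2r h0 (w4M x)).
    by rewrite le_eqVlt; apply/orP; left; apply/eqP; ring.
  have S20 : 0 <= M ^+ 4 * S2.
    apply: mulr_ge0 => //; apply: sumr_ge0 => x _.
    rewrite -!mulrA; apply: mulr_ge0; first exact: pospart_ge0.
    by rewrite mulrA -expr2 mulr_ge0 ?sqr_ge0// ltW.
  lra.
have h1 := qform2_le_pos cwf; have h2 := hC f cf.
have e0 : 0 <= sform m b q K f f by apply: le_trans e1.
rewrite {1}/sform.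
have h3 : K * << fun x => w x ^+ 2 * f x, fun x => w x ^+ 2 * f x >> <=
    `|K| * M ^+ 4 * sform m b q K f f.
  apply: (@le_trans _ _ (`|K| * << fun x => w x ^+ 2 * f x, fun x => w x ^+ 2 * f x >>)).
    by apply: ler_wpM2r => //; exact: ler_norm.
  rewrite -mulrA ler_wpM2l//; apply: le_trans inn _; exact: ler_wpM2l.
have h4 : 2 * M ^+ 4 * hp f f <= 2 * M ^+ 4 * (C * sform m b q K f f).
  by apply: ler_wpM2l => //; exact: mulr_ge0.
have h5 : C3 * << f, f >> <= C3 * sform m b q K f f by exact: ler_wpM2l.
have h6 : 0 <= C3 * C * sform m b q K f f.
  by apply: mulr_ge0 => //; apply: mulr_ge0 => //; exact: ltW.
have h7 : 0 <= M ^+ 4 * sform m b q K f f by exact: mulr_ge0.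
rewrite /C4; lra.
Unshelve. all: by end_near. Qed.

(** The ground state transform is applied with the approximant [phi n] in the place of [u]. It does
    not solve the equation, but its form against [psi n = w ^ 2 * phi n] has the limit that the
    equation predicts. *)
Lemma domain_weighted : dom_form b m q u -> solution b m q lam u -> classV b m q ->
  forall S : {fset X}, (lam1 - lam - rho) * \sum_(x <- S) u x ^+ 2 * w x ^+ 2 * m x <=
    2 * \sum_(x <- A') u x ^+ 2 * c x.
Proof.
move=> /(dom_formP m_gt0 b_graph b_lf hK)[phi aphi] [_ sol] /weight_mul_bound[C [C0 hC]] S.
have [cphi lu iphi ephi] := aphi.
have lphi n := cl (cphi n).
have pt x : phi n x @[n --> \oo] --> u x by exact: l2_cvg_pt.
pose wf (f : X -> R) x := w x * f x.
have lwf f : l2 m f -> l2 m (wf f).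
  move=> /(l2P m_gt0)[C' hC']; apply/(l2P m_gt0); exists (M ^+ 2 * C') => B.
  apply: (@le_trans _ _ (M ^+ 2 * \sum_(x <- B) f x ^+ 2 * m x)); last first.
    by apply: ler_wpM2l => //; exact: sqr_ge0.
  rewrite mulr_sumr; apply: ler_sum => x _; rewrite /wf exprMn -mulrA.
  apply: ler_wpM2r; first by rewrite mulr_ge0 ?sqr_ge0// ltW.
  by rewrite ler_pXn2r ?nnegrE//; exact: le_trans (w_ge0 x) (w_le x).
have nwf f : l2 m f -> << wf f, wf f >> <= M ^+ 2 * << f, f >>.
  move=> lf; apply: (hsum_le_ub (l2_hsum m_gt0 (lwf _ lf) (lwf _ lf))) => B.
  apply: (@le_trans _ _ (M ^+ 2 * \sum_(x <- B) f x * f x * m x)); last first.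
    apply: ler_wpM2l; first exact: sqr_ge0.
    apply: hsum_sum_le (l2_hsum m_gt0 lf lf) => x.
    by rewrite -expr2 mulr_ge0 ?sqr_ge0// ltW.
  rewrite mulr_sumr; apply: ler_sum => x _.
  have -> : wf f x * wf f x * m x = w x ^+ 2 * (f x * f x * m x) by rewrite /wf; ring.
  apply: ler_wpM2r; first by rewrite -expr2 mulr_ge0 ?sqr_ge0// ltW.
  by rewrite ler_pXn2r ?nnegrE//; exact: le_trans (w_ge0 x) (w_le x).
have lwu := lwf _ lu.
have ciwf : << wf (phi n), wf (phi n) >> @[n --> \oo] --> << wf u, wf u >>.
  apply: inner_cvg => // [n|]; first exact: lwf.
  have z : (fun n => M ^+ 2 * << phi n \- u, phi n \- u >>) @ \oo --> 0.
    by rewrite -(mulr0 (M ^+ 2)); exact: cvgMl_tmp.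
  apply: cvg0_le z => n.
  have -> : wf (phi n) \- wf u = wf (phi n \- u) by apply/funext => x; rewrite /wf /=; ring.
  have lb := l2B m_gt0 (lphi n) lu.
  by rewrite (inner_ge0 m_gt0 (lwf _ lb)) nwf.
pose psi n x := w x ^+ 2 * phi n x.
have cpsi n : Cc (psi n) by exact: Cc_mul.
have inpsi f n : << f, psi n >> = << wf f, wf (phi n) >>.
  by rewrite /inner; congr rsum; apply/funext => x; rewrite /psi /wf; ring.
have cwu : << wf u, wf (phi n) >> @[n --> \oo] --> << wf u, wf u >>.
  have c1 : (fun n => << wf (phi n) \- wf u, wf (phi n) \- wf u >>) @ \oo --> 0.
    have z : (fun n => M ^+ 2 * << phi n \- u, phi n \- u >>) @ \oo --> 0.
      by rewrite -(mulr0 (M ^+ 2)); exact: cvgMl_tmp.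
    apply: cvg0_le z => n.
    have -> : wf (phi n) \- wf u = wf (phi n \- u) by apply/funext => x; rewrite /wf /=; ring.
    have lb := l2B m_gt0 (lphi n) lu.
    by rewrite (inner_ge0 m_gt0 (lwf _ lb)) nwf.
  (* The mixed product is recovered by polarisation from norms whose limits are known. *)
  rewrite (_ : << wf u, wf u >> =
    (<< wf u, wf u >> + << wf u, wf u >> - 0) / 2); last by field.
  under eq_cvg => n.
    rewrite (_ : << wf u, wf (phi n) >> = (<< wf (phi n), wf (phi n) >> + << wf u, wf u >>
      - << wf (phi n) \- wf u, wf (phi n) \- wf u >>) / 2); last first.
      by rewrite (innerBB m_gt0 (lwf _ (lphi n)) lwu) (innerC m (wf u)); field.
    over.
  by apply: cvgMr_tmp; apply: cvgB => //; apply: cvgD => //; exact: cvg_cst.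
have [Cb [Cb0 [Nb hNb]]] := approx_bounded m_gt0 b_graph b_lf hK aphi.
have chb : qform2 (phi n) (psi n) @[n --> \oo] --> lam * << wf u, wf u >>.
  (* For fixed [n], the equation identifies [(lam + K) * << u, psi n >>] as the limit in [k] of the
     shifted form of [phi k] and [psi n]. The error is therefore a limit of the form at
     [phi n \- phi k] and [psi n], which Cauchy-Schwarz makes small uniformly, as [psi n] stays
     bounded in the form norm. *)
  have c1 : sform m b q K (phi n) (psi n) - (lam + K) * << u, psi n >> @[n --> \oo] --> 0.
    apply/cvgrPdist_le => e e0.
    have e1 : 0 < e ^+ 2 / (C * Cb) by rewrite divr_gt0 ?exprn_gt0// mulr_gt0.
    have [N hN] := ephi _ e1; exists (maxn N Nb) => // n /=; rewrite geq_max => /andP[nN nNb].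
    rewrite sub0r normrN -(ler_pXn2r (ltn0Sn 1)) ?nnegrE ?(ltW e0)// real_normK ?num_real//.
    have [B hB] := (CcP (psi n)).1 (cpsi n).
    have lim : sform m b q K (phi k) (psi n) @[k --> \oo] --> (lam + K) * << u, psi n >>.
      rewrite mulrDl; apply: cvgD.
        rewrite (_ : lam * _ = \sum_(x <- B) psi n x * (m x * formalH b m q u x)).
          exact: (qform2_cvg m_gt0 b_graph b_lf cphi hB pt).
        rewrite /inner (@rsum_fin _ _ _ B) => [|x /hB ->]; last by rewrite mulr0 mul0r.
        rewrite mulr_sumr; apply: eq_bigr => x _.
        have /eqP := sol x; rewrite subr_eq0 => /eqP ->; ring.
      apply: cvgMl_tmp.
      rewrite /inner (@rsum_fin _ _ _ B) => [|x /hB ->]; last by rewrite mulr0 mul0r.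
      under eq_cvg => k.
        rewrite (@rsum_fin _ _ _ B) => [|x /hB ->]; last by rewrite mulr0 mul0r.
        over.
      by apply: cvg_sumr => x; apply: cvgMr_tmp; exact: cvgMr_tmp.
    have lim2 : (sform m b q K (phi n) (psi n) - sform m b q K (phi k) (psi n)) ^+ 2 @[k --> \oo] -->
        (sform m b q K (phi n) (psi n) - (lam + K) * << u, psi n >>) ^+ 2.
      have l1 : sform m b q K (phi n) (psi n) - sform m b q K (phi k) (psi n) @[k --> \oo] -->
          sform m b q K (phi n) (psi n) - (lam + K) * << u, psi n >>.
        by apply: cvgB => //; exact: cvg_cst.
      by rewrite expr2; under eq_cvg do rewrite expr2; exact: cvgM.
    apply: (cvgr_to_le lim2); exists N => // k /= Nk.
    have cd := CcB (cphi n) (cphi k).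
    rewrite -(sformBl q m_gt0 b_graph b_lf K (cphi n) (cphi k) (cpsi n)).
    apply: le_trans (sform_CS m_gt0 b_graph b_lf hK cd (cpsi n)) _.
    have p1 : sform m b q K (psi n) (psi n) <= C * Cb.
      by apply: le_trans (hC _ (cphi n)) _; apply: ler_wpM2l (hNb n nNb); exact: ltW.
    apply: le_trans (ler_wpM2l (sform_ge0 m_gt0 hK cd) p1) _.
    by rewrite -ler_pdivlMr ?mulr_gt0//; exact/ltW/hN.
  rewrite (_ : lam * << wf u, wf u >> =
    0 + (lam + K) * << wf u, wf u >> - K * << wf u, wf u >>); last by ring.
  under eq_cvg => n.
    rewrite (_ : qform2 (phi n) (psi n) = (sform m b q K (phi n) (psi n) - (lam + K) * << u, psi n >>)
      + (lam + K) * << wf u, wf (phi n) >> - K * << wf (phi n), wf (phi n) >>); last first.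
      by rewrite /sform !inpsi; ring.
    over.
  by apply: cvgB; [apply: cvgD => //|]; exact: cvgMl_tmp.
have ineq n : (lam1 - rho) * << wf (phi n), wf (phi n) >> <=
    qform2 (phi n) (psi n) + \sum_(x <- A') phi n x ^+ 2 * c x.
  have cw : Cc (wf (phi n)) by exact: Cc_mul.
  have E : wf (phi n) = (fun x => phi n x * w x) by apply/funext => x; rewrite /wf mulrC.
  have cw' : Cc (fun x => phi n x * w x) by rewrite -E.
  have := lower cw (fun x xA => etrans (congr1 (fun z => z * phi n x) (w_A xA)) (mul0r _)).
  near (tot X) => B.
  rewrite (near (qform2_near m_gt0 b_graph b_lf q cw cw) B)//.
  rewrite (near (qform2_near m_gt0 b_graph b_lf q (cphi n) (cpsi n)) B)//.
  rewrite E bil_ground.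
  have -> : (fun x => phi n x * w x ^+ 2) = psi n by apply/funext => x; rewrite /psi mulrC.
  have A'B : (A' `<=` B)%fset by near: B; exact: near_totally.
  rewrite (near (inner_near m _ cw') B)//.
  have h1 := ground_rem_le b_graph B (phi n) w.
  have h2 : 2^-1 * \sum_(x <- B) phi n x ^+ 2 * \sum_(y <- B) b x y * (w x - w y) ^+ 2 <=
      rho * \sum_(x <- B) phi n x * w x * (phi n x * w x) * m x
      + \sum_(x <- A') phi n x ^+ 2 * c x.
    rewrite -(@big_fset_supp _ _ _ A' B) => [|//|x /c_A' ->]; last by rewrite mulr0.
    rewrite !mulr_sumr -big_split /=; apply: ler_sum => x _.
    have p2 := sqr_ge0 (phi n x); have := ler_wpM2l p2 (w_grad x B).
    have : 0 <= phi n x ^+ 2 * c x by exact: mulr_ge0.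
    lra.
  lra.
have limR : qform2 (phi n) (psi n) + \sum_(x <- A') phi n x ^+ 2 * c x @[n --> \oo] -->
    lam * << wf u, wf u >> + \sum_(x <- A') u x ^+ 2 * c x.
  apply: cvgD => //; apply: cvg_sumr => x; apply: cvgMr_tmp.
  by rewrite expr2; under eq_cvg do rewrite expr2; exact: cvgM.
have limL : (lam1 - rho) * << wf (phi n), wf (phi n) >> @[n --> \oo] -->
    (lam1 - rho) * << wf u, wf u >> by exact: cvgMl_tmp.
have fin : (lam1 - rho) * << wf u, wf u >> <=
    lam * << wf u, wf u >> + \sum_(x <- A') u x ^+ 2 * c x.
  by apply: (ler_cvg_to limL limR); exact: nearW.
have s0 : 0 <= \sum_(x <- A') u x ^+ 2 * c x.
  by apply: sumr_ge0 => x _; rewrite mulr_ge0 ?sqr_ge0.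
have sS : \sum_(x <- S) u x ^+ 2 * w x ^+ 2 * m x <= << wf u, wf u >>.
  have F0 x : 0 <= wf u x * wf u x * m x by rewrite -expr2 mulr_ge0 ?sqr_ge0// ltW.
  apply: le_trans (hsum_sum_le S F0 (l2_hsum m_gt0 lwu lwu)).
  by apply: ler_sum => x _; rewrite le_eqVlt; apply/orP; left; apply/eqP; rewrite /wf; ring.
have k0 : 0 <= lam1 - lam - rho by rewrite subr_ge0 ltW.
have := ler_wpM2l k0 sS; move: fin s0; lra.
Unshelve. all: by end_near. Qed.

End Agmon.

(** * Removing the truncation and conclusion *)

Lemma bounded_inner (R : realType) (X : choiceType) (m : X -> R) (b : X -> X -> R) (q : X -> R) :
  (forall x, 0 < m x) -> is_graph b -> locally_finite b -> bounded_from_below b m q ->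
  exists K : R, forall f, Cc f -> inner m f f <= qform2 m b q f f + K * inner m f f.
Proof.
move=> m0 gb lfb [C hC]; exists (C + 1) => f cf.
by have := hC f cf; rewrite inner_rsum qform_hb//; lra.
Qed.

Lemma wt_limit (R : realType) (X : choiceType) (d : X -> X -> R) (o : X) (r : R)
    (A : {fset X}) (N : R) x : x \notin A -> d o x <= N ->
  wt d o r A N x ^+ 2 = expR (r * d o x).
Proof.
move=> /negbTE xA dN; rewrite /wt xA expr2 -expRD -splitr.
by congr (expR (r * _)); apply/min_idPl.
Qed.

Lemma l2_weight (R : realType) (X : choiceType) (m : X -> R) (d : X -> X -> R) (o : X) (r : R)
    (A : {fset X}) (u : X -> R) (kappa C : R) :
  (forall x, 0 < m x) -> (forall x, 0 <= d o x) -> 0 < kappa ->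
  (forall (N : R) (S : {fset X}),
    kappa * \sum_(x <- S) u x ^+ 2 * wt d o r A N x ^+ 2 * m x <= C) ->
  l2 (fun x => expR (r * d o x) * m x) u.
Proof.
move=> m0 d0 k0 h; apply/l2P; first by move=> x; rewrite mulr_gt0 ?expR_gt0.
pose G x := u x ^+ 2 * (expR (r * d o x) * m x).
have G0 x : 0 <= G x by rewrite mulr_ge0 ?sqr_ge0// mulr_ge0 ?expR_ge0// ltW.
exists (C / kappa + \sum_(x <- A) G x) => S.
(* A level above every distance in [S], so that the truncation is not felt there; [h] holds with the
   same [C] for all levels. The points of [A], where the weight vanishes, are added by hand. *)
pose N := \sum_(x <- S) d o x.
have dN x : x \in S -> d o x <= N.
  by move=> xS; rewrite /N (big_fsetD1 x)//= lerDl sumr_ge0.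
apply: (@le_trans _ _ (\sum_(x <- S) (u x ^+ 2 * wt d o r A N x ^+ 2 * m x +
    (if x \in A then G x else 0)))).
  rewrite !big_seq; apply: ler_sum => x xS; rewrite -/(G x); case: ifP => xA.
    rewrite lerDr mulr_ge0//; last exact: ltW.
    by rewrite mulr_ge0 ?sqr_ge0.
  by rewrite addr0 (wt_limit _ (negbT xA) (dN x xS)) /G mulrA.
rewrite big_split /=; apply: lerD.
  by rewrite ler_pdivlMr// mulrC; exact: h.
pose H x := if x \in A then G x else 0.
have H0 x : 0 <= H x by rewrite /H; case: ifP.
apply: (le_trans (le_sum_fset H0 (fsubsetUr A S))).
rewrite (@big_fset_supp _ _ H A) ?fsubsetUl//; last by move=> x /negbTE xA; rewrite /H xA.
by rewrite !big_seq; apply: ler_sum => x xA; rewrite /H xA.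
Qed.

Lemma exponential_decay (R : realType) (X : choiceType) (m : X -> R)
    (b : X -> X -> R) (q : X -> R) (d : X -> X -> R) (lam : R) (u : X -> R)
    (m_gt0 : forall x, 0 < m x) (b_graph : is_graph b) (b_lf : locally_finite b)
    (h_bounded : bounded_from_below b m q) (d_intrinsic : intrinsic_metric b m d)
    (d_jump : forall x y, 0 < b x y -> d x y <= 1)
    (u_cases :
       (approximable b m u /\
          (solution b m q lam u \/ positive_subsolution b m q lam u))
       \/ [/\ domH b m q u, solution b m q lam u & classV b m q])
    (o : X) (r : R) :
  0 < r -> ((rate r)%:E < lambda0_ess b m q - lam%:E)%E ->
  l2 (fun x => expR (r * d o x) * m x) u.
Proof.
move=> r0 hr; have [K hK] := bounded_inner m_gt0 b_graph b_lf h_bounded.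
(* Strict inequality leaves a level strictly between [lam + rate r] and the bottom of the essential
   spectrum, which may be infinite. *)
have [lam1 hlam1 hess] : exists2 lam1 : R, rate r < lam1 - lam & (lam1%:E < lambda0_ess b m q)%E.
  case: (lambda0_ess b m q) hr => [s| |]; last by [].
    by rewrite -EFinB lte_fin => hs; exists ((s + lam + rate r) / 2); rewrite ?lte_fin; lra.
  by move=> _; exists (lam + rate r + 1); [lra|rewrite ltry].
have [A hA] := lower_bound_outside_finite m_gt0 b_graph b_lf hK hess.
have [d0 _ _ _ _] := d_intrinsic.
have rt0 : 0 <= rate r.
  by rewrite /rate mulr_ge0 ?sqr_ge0// divr_ge0// addr_ge0// expR_ge0.
pose C := 2 * \sum_(x <- hull b A) u x ^+ 2 * wt_bd b d o r A x.
apply: (@l2_weight _ _ m d o r A u (lam1 - lam - rate r) C) => // [|N S]; first by lra.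
have wA x : x \in A -> wt d o r A N x = 0 by rewrite /wt => ->.
have bdA x : x \notin hull b A -> wt_bd b d o r A x = 0 by move=> /negbTE h; rewrite /wt_bd h.
have grad x B := wt_grad m_gt0 b_graph b_lf d_intrinsic d_jump o A r0 N x B.
have bd0 x : 0 <= wt_bd b d o r A x by exact: wt_bd_ge0.
have wM x : wt d o r A N x <= expR (r * N / 2) by exact: wt_le.
have w0 x : 0 <= wt d o r A N x by exact: wt_ge0.
case: u_cases => [[ua us]|[[f [du _ _]] us uV]].
  exact: (approximable_weighted m_gt0 b_graph b_lf hA wA w0 wM bd0 bdA grad rt0 hlam1 ua us).
exact: (domain_weighted m_gt0 b_graph b_lf hA wA w0 wM bd0 bdA grad rt0 hlam1 hK du us uV).
Qed.

Theorem theorem4p4 (R : realType) (X : countType) (m : X -> R)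
    (b : X -> X -> R) (q : X -> R) (d : X -> X -> R) (lam : R) (u : X -> R)
    (X_infinite : infinite_set [set: X])
    (m_gt0 : forall x, 0 < m x)
    (b_graph : is_graph b)
    (b_lf : locally_finite b)
    (h_bounded : bounded_from_below b m q)
    (d_intrinsic : intrinsic_metric b m d)
    (d_jump : jump_size b d = 1%E)
    (lam_lt : (lam%:E < lambda0_ess b m q)%E)
    (u_cases :
       (approximable b m u /\
          (solution b m q lam u \/ positive_subsolution b m q lam u))
       \/ [/\ domH b m q u, solution b m q lam u & classV b m q])
    (o : X) :
  let a := (lambda0_ess b m q - lam%:E)%E in
  [/\ exists2 r : R, 0 < r & l2 (fun x => expR (r * d o x) * m x) u,
      forall r : R, 0 < r ->
        ((r ^+ 2 * ((1 + expR r) / 16))%:E < a)%E ->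
        l2 (fun x => expR (r * d o x) * m x) u
    & (a <= 1)%E ->
        let r := 2 * fine a * expR (- fine a) in
        0 < r /\ ((r ^+ 2 * ((1 + expR r) / 16))%:E < a)%E].
Proof.
move=> a.
have jump x y : 0 < b x y -> d x y <= 1.
  by move=> bxy; rewrite -lee_fin -d_jump; apply: ereal_sup_ubound; exists (x, y).
have decay r : 0 < r -> ((rate r)%:E < a)%E -> l2 (fun x => expR (r * d o x) * m x) u.
  exact: exponential_decay.
have a0 : (0 < a)%E by rewrite sube_gt0.
split => [|//|].
(* Since [a] may exceed 1 or be infinite, the explicit rate is taken at a smaller [a'] that is at
   most 1. *)
- have [a' [a'0 a'1 a'a]] : exists a' : R, [/\ 0 < a', a' <= 1 & (a'%:E <= a)%E].
    case: (a) a0 => [s| |]; last by [].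
      rewrite lte_fin => s0; exists (Num.min s 1).
      by rewrite lt_min s0 ltr01 ge_min lexx orbT lee_fin ge_min lexx.
    by move=> _; exists 1; rewrite ltr01 lexx leey.
  have [r0 hr] := rate_bound a'0 a'1.
  by exists (2 * a' * expR (- a')) => //; apply: decay => //; apply: lt_le_trans a'a; rewrite lte_fin.
- move=> a1 r.
  have afin : a \is a fin_num.
    by rewrite ge0_fin_numE ?(ltW a0)//; apply: le_lt_trans a1 _; rewrite ltry.
  have fa0 : 0 < fine a by rewrite -lte_fin fineK.
  have fa1 : fine a <= 1 by rewrite -lee_fin fineK.
  have [r0 hr] := rate_bound fa0 fa1.
  by split => //; rewrite -(fineK afin) lte_fin.
Qed.
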